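(* Let $V \subset (\mathbb{R}_{>0})^n$ be a closed semi-algebraic set. Then there exist a positive quantifier-free $L_{\mathcal{OS}^{\mathbb{R}}}$-formula $\phi(x_1, \dots, x_n, y_1, \dots, y_m)$ and constants $a_1, \dots, a_m \in \mathbb{R}_{>0}$ such that $$V = \{ x \in (\mathbb{R}_{>0})^n : \phi(x_1, \dots, x_n, a_1, \dots, a_m)\},$$ $$\mathcal{A}_0(V) = \{x \in \mathbb{R}^n : \phi_0(x_1, \dots, x_n, 0, \dots, 0)\}.$$
   Context: Closedness of $V$ refers to the topology of $(\mathbb{R}_{>0})^n$. A semi-algebraic set is a subset of $\mathbb{R}^n$ definable (with real parameters) in the ordered field of real numbers. Language: $\mathcal{OS}^{\mathbb{R}}$ is the set of symbols consisting of a binary relation $\le$, binary functions $+,\cdot$, and a unary function symbol $f_\alpha$ for every $\alpha\in\mathbb{R}$ (no constants); $L_{\mathcal{OS}^{\mathbb{R}}}$ is the corresponding first-order language with equality. A positive formula is one written without $\neg,\Rightarrow,\Leftrightarrow$; a positive quantifier-free formula is thus built from atomic formulas using only $\vee,\wedge$. In the description of $V$ the formula is interpreted in $\mathbb{R}_{>0}$ with the usual $\le,+,\cdot$ and $f_\alpha(x)=x^\alpha$. $\phi_0$ denotes $\phi$ interpreted in the tropical semifield $\mathbb{R}^{trop}$: the set $\mathbb{R}$ with the usual $\le$, with $+$ interpreted as $\max$, $\cdot$ interpreted as the usual addition, and $f_\alpha$ interpreted as $x\mapsto\alpha x$. In the description of $\mathcal{A}_0(V)$ each parameter $y_i$ is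 given the value $0$. Logarithmic limit set: for $V\subset(\mathbb{R}_{>0})^n$ and $t\in(0,1)$ let $\mathrm{Log}_{1/t}(x_1,\dots,x_n)=(\log_{1/t}x_1,\dots,\log_{1/t}x_n)$ and $\mathcal{A}_t(V)=\mathrm{Log}_{1/t}(V)\subset\mathbb{R}^n$. For a family $(S_t)_{t\in(0,\varepsilon)}$ of subsets of $\mathbb{R}^n$, $\lim_{t\to0}S_t$ is the set of $y\in\mathbb{R}^n$ such that $(y,0)$ lies in the closure of $\{(x,t)\in\mathbb{R}^n\times(0,\varepsilon): x\in S_t\}$ in $\mathbb{R}^n\times[0,\varepsilon)$. Then $\mathcal{A}_0(V)=\lim_{t\to0}\mathcal{A}_t(V)$.
   Formalization: V is assumed nonempty: for empty V the limit set A_0(V) is empty, while every positive quantifier-free formula holds tropically at x = 0, y = 0, so the statement fails there. *)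

(* Defs.v *)
(* Points of R^n are row vectors, indexed from 0. *)
From mathcomp Require Import all_boot all_order all_algebra.
From mathcomp Require Import all_classical all_reals all_analysis.
(* Not imported: it opens global scopes that clash with MathComp notations. *)
From mathcomp Require ordered_qelim.

Set Implicit Arguments.
Unset Strict Implicit.
Unset Printing Implicit Defensive.
Import Order.TTheory GRing.Theory Num.Theory.
Import numFieldNormedType.Exports.

Local Open Scope classical_set_scope.
Local Open Scope ring_scope.

(* k is the number of free variables. The symbols <=, +, * and f_alpha (for
   every alpha in R) are the only non-logical ones: there are no constants. *)
Inductive os_term (R : Type) (k : nat) : Type :=
| OSVar of 'I_k
| OSAdd of os_term R k & os_term R k
| OSMul of os_term R k & os_term R k
| OSPow of R & os_term R k.

(* Positive quantifier-free formulas. There is no atom for falsity. *)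
Inductive os_pqf (R : Type) (k : nat) : Type :=
| OSEq of os_term R k & os_term R k
| OSLe of os_term R k & os_term R k
| OSAnd of os_pqf R k & os_pqf R k
| OSOr of os_pqf R k & os_pqf R k.

Record os_interp (R : Type) := OSInterp {
  os_le : R -> R -> Prop;
  os_add : R -> R -> R;
  os_mul : R -> R -> R;
  os_pow : R -> R -> R  (* os_pow alpha interprets f_alpha *)
}.

Fixpoint os_eval (R : Type) (k : nat) (M : os_interp R) (e : 'rV[R]_k)
    (t : os_term R k) : R :=
  match t with
  | OSVar i => e ord0 i
  | OSAdd t1 t2 => os_add M (os_eval M e t1) (os_eval M e t2)
  | OSMul t1 t2 => os_mul M (os_eval M e t1) (os_eval M e t2)
  | OSPow alpha t1 => os_pow M alpha (os_eval M e t1)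
  end.

Fixpoint os_holds (R : Type) (k : nat) (M : os_interp R) (e : 'rV[R]_k)
    (phi : os_pqf R k) : Prop :=
  match phi with
  | OSEq t1 t2 => os_eval M e t1 = os_eval M e t2
  | OSLe t1 t2 => os_le M (os_eval M e t1) (os_eval M e t2)
  | OSAnd phi1 phi2 => os_holds M e phi1 /\ os_holds M e phi2
  | OSOr phi1 phi2 => os_holds M e phi1 \/ os_holds M e phi2
  end.

(* The structure on R_{>0}, to be used at positive valuations only: they give
   positive values to all terms, and, formulas being quantifier-free, the
   operations are never applied outside R_{>0}. *)
Definition os_pos (R : realType) : os_interp R :=
  OSInterp (fun x y => x <= y) (fun x y => x + y) (fun x y => x * y)
           (fun alpha x => x `^ alpha).

Definition os_trop (R : realType) : os_interp R :=
  OSInterp (fun x y => x <= y) (fun x y => Num.max x y) (fun x y => x + y)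
           (fun alpha x => alpha * x).

Definition pos_orthant (R : realType) (n : nat) : set 'rV[R]_n :=
  [set x | forall i, 0 < x ord0 i].

(* The variables 'X_0, ..., 'X_(n-1) are the coordinates of x, and the constants
   of R occurring in f are the parameters; free variables beyond n take the
   value 0. Terms may contain the (definable) inverse. *)
Definition semialgebraic (R : realType) (n : nat) (V : set 'rV[R]_n) : Prop :=
  exists f : ordered_qelim.ord.formula R,
    V = [set x | ordered_qelim.ord.holds [tuple x ord0 i | i < n] f].

Definition log_map (R : realType) (n : nat) (b : R) (x : 'rV[R]_n) : 'rV[R]_n :=
  \row_i (ln (x ord0 i) / ln b).

Definition amoeba (R : realType) (n : nat) (V : set 'rV[R]_n) (t : R) :
    set 'rV[R]_n :=
  log_map (1 / t) @` V.

(* The limit for t -> 0 of a family S_t, t in (0, eps); the closure is taken in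
   R^n x [0, eps). *)
Definition family_lim (R : realType) (n : nat) (eps : R)
    (S : R -> set 'rV[R]_n) : set 'rV[R]_n :=
  let Y : set ('rV[R]_n * R) := [set p | 0 <= p.2 < eps] in
  let E : set (subspace Y) := [set p | 0 < p.2 < eps /\ S p.2 p.1] in
  [set y | closure E (y, 0)].

Definition log_limit_set (R : realType) (n : nat) (V : set 'rV[R]_n) :
    set 'rV[R]_n :=
  family_lim 1 (amoeba V).

(* Main.v *)
Require Import Defs.
From mathcomp Require Import all_boot all_order all_algebra.
From mathcomp Require Import all_classical all_reals all_analysis.
From mathcomp Require ordered_qelim qe_rcf.
From mathcomp Require Import ring lra zify.
Import Order.TTheory GRing.Theory Num.Theory.
Import numFieldNormedType.Exports.
Local Open Scope classical_set_scope.
Local Open Scope ring_scope.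
Set Implicit Arguments.
Unset Strict Implicit.
Unset Printing Implicit Defensive.

(** Work in logarithmic coordinates on the positive orthant: a monomial with
    integer exponents becomes exp of a linear form, and a set is semi-algebraic
    there when membership depends only on the signs of finitely many Laurent
    polynomials.  The formula phi is a conjunction of two formulas, one for each
    of the two equalities to be obtained.

    The tool behind both is [dominance].  Along a filter on which no nonzero
    integral combination of certain log-coordinates stays bounded, each Laurent
    polynomial in these coordinates has a dominant monomial, so its sign is
    constant on an unbounded region cut out by finitely many inequalities
    [M < b . log x].  After quantifier elimination this applies to a projection
    of a semi-algebraic set: if the set belongs to the filter, then its
    projection contains a whole region of this shape.

    _The polyhedral part._  [cone_cover]: V is covered by finitely many sets
    [a . log x <= K, for a in A] whose asymptotic cones [a . w <= 0, for a in A]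
    lie in the logarithmic limit set.  By compactness it suffices to find one
    such set in each ultrafilter containing V.  There, choose a maximal family
    of log-coordinates independent modulo bounded functions: the other
    coordinates are, up to bounded factors, monomials with rational exponents in
    these, and [dominance] describes the family itself.  This covering is a
    positive formula psi, true on V, whose tropical reading is contained in the
    limit set.

    _The finiteness theorem._  [closed_posdef]: V itself is given by a
    positive formula.  A sign cell off V has the form {f = 0, all g_i > 0} with
    f >= 0; writing G for the product of the g_i, it is enough to have a
    Lojasiewicz inequality [1 <= f (h + 1/G)^k] on V where all g_i > 0, because
    then the conditions [some g_i <= 0] or [G^k <= f (h G + 1)^k] hold on V and
    fail on the cell.  Since h + 1/G is proper, f is bounded away from 0 where
    h + 1/G is bounded.  So if the inequality failed for every k, then h + 1/G
    would tend to infinity along a filter on which -log f is infinitely large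
    compared with log (h + 1/G), and [dominance] would produce points on a level
    set of h + 1/G with arbitrarily small f, which is excluded.

    _Conclusion._  Evaluation of a term in rescaled logarithms converges to its
    tropical value, so any positive formula true on V is tropically true on the
    limit set ([log_limit_set_sub]).  Hence the conjunction of the formula of V
    and psi has both properties.  A single parameter, e, is enough: a constant
    c > 0 is the value at e of the function symbol for the exponent ln c. *)

(** * Log-coordinates, Laurent polynomials and semi-algebraic sets *)

Section LogCoordinates.
Context {R : realType} {n : nat}.
Implicit Types (x w : 'rV[R]_n) (a b : 'rV[int]_n).

Definition lnv x : 'rV[R]_n := \row_i ln (x ord0 i).
Definition expv w : 'rV[R]_n := \row_i expR (w ord0 i).

Definition lin a w : R := \sum_i (a ord0 i)%:~R * w ord0 i.

Lemma lnvE x i : lnv x ord0 i = ln (x ord0 i).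
Proof. by rewrite mxE. Qed.

Lemma expv_pos w : pos_orthant (expv w).
Proof. by move=> i; rewrite mxE expR_gt0. Qed.

Lemma expvK w : lnv (expv w) = w.
Proof. by apply/rowP => i; rewrite !mxE expRK. Qed.

Lemma lin0 w : lin 0 w = 0.
Proof. by rewrite /lin big1// => i _; rewrite mxE mul0r. Qed.

Lemma linD a b w : lin (a + b) w = lin a w + lin b w.
Proof.
by rewrite /lin -big_split; apply: eq_bigr => i _ /=; rewrite mxE intrD mulrDl.
Qed.

Lemma linN a w : lin (- a) w = - lin a w.
Proof.
by rewrite /lin -sumrN; apply: eq_bigr => i _; rewrite mxE rmorphN mulNr.
Qed.

Lemma linB a b w : lin (a - b) w = lin a w - lin b w.
Proof. by rewrite linD linN. Qed.

Lemma linDr a w w' : lin a (w + w') = lin a w + lin a w'.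
Proof.
by rewrite /lin -big_split; apply: eq_bigr => i _ /=; rewrite mxE mulrDr.
Qed.

Lemma linZr a (c : R) w : lin a (c *: w) = c * lin a w.
Proof.
by rewrite /lin big_distrr; apply: eq_bigr => i _ /=; rewrite mxE mulrCA.
Qed.

Lemma lin_delta i w : lin (delta_mx ord0 i) w = w ord0 i.
Proof.
rewrite /lin (bigD1 i)//= big1 ?addr0 => [|j /negPf ji].
  by rewrite mxE !eqxx mul1r.
by rewrite mxE ji andbF mul0r.
Qed.

End LogCoordinates.

Section Laurent.
Context {R : realType} {n : nat}.
Implicit Types (x : 'rV[R]_n) (a : 'rV[int]_n) (f g : 'rV[R]_n -> R).
Implicit Types (P Q : seq (R * 'rV[int]_n)).

Definition leval P x : R := \sum_(t <- P) t.1 * expR (lin t.2 (lnv x)).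

(** Exponents may be negative, and equality is only required where log x makes
    sense. *)
Definition laurent f :=
  exists P, forall x, pos_orthant x -> f x = leval P x.

Lemma laurentP P : laurent (leval P).
Proof. by exists P. Qed.

Lemma eq_laurent f g : (forall x, pos_orthant x -> g x = f x) ->
  laurent f -> laurent g.
Proof. by move=> fg [P fP]; exists P => x xX; rewrite fg// fP. Qed.

Lemma laurent_monomial a : laurent (fun x => expR (lin a (lnv x))).
Proof. by exists [:: (1, a)] => x _; rewrite /leval big_seq1 mul1r. Qed.

Lemma laurent_cst (c : R) : laurent (fun=> c).
Proof.
by exists [:: (c, 0)] => x _; rewrite /leval big_seq1 lin0 expR0 mulr1.
Qed.

Lemma laurentD f g : laurent f -> laurent g -> laurent (fun x => f x + g x).
Proof.
move=> [P fP] [Q gQ]; exists (P ++ Q) => x xX.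
by rewrite /leval big_cat fP// gQ.
Qed.

Lemma laurentM f g : laurent f -> laurent g -> laurent (fun x => f x * g x).
Proof.
move=> [P fP] [Q gQ].
exists [seq (t.1 * u.1, t.2 + u.2) | t <- P, u <- Q] => x xX.
rewrite fP// gQ// /leval big_allpairs_dep/= big_distrl/=; apply: eq_bigr => t _.
by rewrite big_distrr/=; apply: eq_bigr => u _; rewrite linD expRD mulrACA.
Qed.

Lemma laurentN f : laurent f -> laurent (fun x => - f x).
Proof.
move=> lf; apply: eq_laurent (laurentM (laurent_cst (-1)) lf) => x _.
by rewrite mulN1r.
Qed.

Lemma laurentB f g : laurent f -> laurent g -> laurent (fun x => f x - g x).
Proof. by move=> lf lg; apply: laurentD => //; apply: laurentN. Qed.

Lemma laurentX f k : laurent f -> laurent (fun x => f x ^+ k).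
Proof.
move=> lf; elim: k => [|k IH]; first exact: laurent_cst.
by apply: eq_laurent (laurentM lf IH) => x _; rewrite exprS.
Qed.

Lemma laurent_sum (I : eqType) (s : seq I) (F : I -> 'rV[R]_n -> R) :
  {in s, forall i, laurent (F i)} -> laurent (fun x => \sum_(i <- s) F i x).
Proof.
elim: s => [_|i s IH lF].
  by apply: eq_laurent (laurent_cst 0) => x _; rewrite big_nil.
have li : laurent (F i) by apply: lF; rewrite mem_head.
have ls : laurent (fun x => \sum_(i <- s) F i x).
  by apply: IH => j js; apply: lF; rewrite inE js orbT.
by apply: eq_laurent (laurentD li ls) => x _; rewrite big_cons.
Qed.

Lemma laurent_prod (I : eqType) (s : seq I) (F : I -> 'rV[R]_n -> R) :
  {in s, forall i, laurent (F i)} -> laurent (fun x => \prod_(i <- s) F i x).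
Proof.
elim: s => [_|i s IH lF].
  by apply: eq_laurent (laurent_cst 1) => x _; rewrite big_nil.
have li : laurent (F i) by apply: lF; rewrite mem_head.
have ls : laurent (fun x => \prod_(i <- s) F i x).
  by apply: IH => j js; apply: lF; rewrite inE js orbT.
by apply: eq_laurent (laurentM li ls) => x _; rewrite big_cons.
Qed.

Lemma laurent_coord i : laurent (fun x => x ord0 i).
Proof.
apply: eq_laurent (laurent_monomial (delta_mx ord0 i)) => x xX.
by rewrite lin_delta mxE lnK// posrE.
Qed.

Lemma laurent_coordV i : laurent (fun x => (x ord0 i)^-1).
Proof.
apply: eq_laurent (laurent_monomial (- delta_mx ord0 i)) => x xX.
by rewrite linN lin_delta mxE expRN lnK// posrE.
Qed.

End Laurent.

Section SemialgebraicSets.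
Context {R : realType} {n : nat}.
Implicit Types (x y : 'rV[R]_n) (S T : set 'rV[R]_n).
Implicit Types (P : seq (R * 'rV[int]_n)).

Definition sign_determined (Ps : seq (seq (R * 'rV[int]_n))) S :=
  forall x y, pos_orthant x -> pos_orthant y ->
    {in Ps, forall P, Num.sg (leval P x) = Num.sg (leval P y)} -> S x -> S y.

(** By quantifier elimination these are the semi-algebraic subsets of the
    orthant.  The sign form is the one on which dominance acts, and passing to
    more variables only pads exponents with zeros. *)
Definition semialg S := exists Ps, sign_determined Ps S.

Lemma eq_semialg S T : (forall x, pos_orthant x -> T x <-> S x) ->
  semialg S -> semialg T.
Proof.
move=> ST [Ps SPs]; exists Ps => x y xX yX xy /(ST _ xX) Sx.
by apply/ST => //; apply: SPs xy Sx.
Qed.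

Lemma semialgI S T : semialg S -> semialg T -> semialg (S `&` T).
Proof.
move=> [Ps SP] [Qs TQ]; exists (Ps ++ Qs) => x y xX yX xy [Sx Tx]; split.
  by apply: SP Sx => // P PPs; apply: xy; rewrite mem_cat PPs.
by apply: TQ Tx => // P PPs; apply: xy; rewrite mem_cat PPs orbT.
Qed.

Lemma semialgC S : semialg S -> semialg (~` S).
Proof.
move=> [Ps SP]; exists Ps => x y xX yX xy nSx Sy; apply: nSx.
by apply: SP Sy => // P PPs; rewrite xy.
Qed.

Lemma semialgU S T : semialg S -> semialg T -> semialg (S `|` T).
Proof.
move=> SS ST; rewrite -[_ `|` _]setCK setCU.
by apply/semialgC/semialgI; apply: semialgC.
Qed.

Lemma semialg_cst (Q : Prop) : semialg [set _ | Q].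
Proof. by exists [::]. Qed.

Lemma semialg_sg (f : 'rV[R]_n -> R) (D : set R) : laurent f ->
  semialg [set x | D (Num.sg (f x))].
Proof.
move=> [P fP]; exists [:: P] => x y xX yX xy /=.
by rewrite !fP// xy ?inE.
Qed.

Lemma semialg_gt0 (f : 'rV[R]_n -> R) : laurent f -> semialg [set x | 0 < f x].
Proof.
move=> lf; apply: eq_semialg (semialg_sg [set c | 0 < c] lf) => x _ /=.
by rewrite sgr_gt0.
Qed.

Lemma semialg_ge0 (f : 'rV[R]_n -> R) : laurent f -> semialg [set x | 0 <= f x].
Proof.
move=> lf; apply: eq_semialg (semialg_sg [set c | 0 <= c] lf) => x _ /=.
by rewrite sgr_ge0.
Qed.

Lemma semialg_eq0 (f : 'rV[R]_n -> R) : laurent f -> semialg [set x | f x = 0].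
Proof.
move=> lf; apply: eq_semialg (semialg_sg [set c | c = 0] lf) => x _ /=.
by split=> [->|/eqP]; rewrite ?sgr0// sgr_eq0 => /eqP.
Qed.

Lemma semialg_forall (I : eqType) (s : seq I) (F : I -> set 'rV[R]_n) :
  {in s, forall i, semialg (F i)} -> semialg [set x | {in s, forall i, F i x}].
Proof.
elim: s => [_|i s IH sF].
  by apply: eq_semialg (semialg_cst True) => x _; split.
have sAi : semialg (F i) by apply: sF; rewrite mem_head.
have sAs : semialg [set x | {in s, forall i, F i x}].
  by apply: IH => j js; apply: sF; rewrite inE js orbT.
apply: eq_semialg (semialgI sAi sAs) => x _; split => /= [H|[Hi H] j].
  by split=> [|j js]; apply: H; rewrite inE ?eqxx ?js ?orbT.
by rewrite inE => /orP[/eqP->//|/H].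
Qed.

End SemialgebraicSets.

Section Terms.
Context {R : realType} {n : nat}.
Implicit Types (x y : 'rV[R]_n) (P : seq (R * 'rV[int]_n)).

Definition env x : seq R := [tuple x ord0 i | i < n].

Lemma size_env x : size (env x) = n.
Proof. by rewrite size_tuple. Qed.

Lemma nth_env x (i : 'I_n) : (env x)`_i = x ord0 i.
Proof. by rewrite /env -tnth_nth tnth_mktuple. Qed.

Definition exp_term (z : int) (t : GRing.term R) : GRing.term R :=
  match z with
  | Posz k => GRing.Exp t k
  | Negz k => GRing.Inv (GRing.Exp t k.+1)
  end.

Definition monomial_term (a : 'rV[int]_n) : GRing.term R :=
  foldr (fun i t => GRing.Mul (exp_term (a ord0 i) (GRing.Var _ i)) t)
    (GRing.NatConst _ 1) (enum 'I_n).

Definition leval_term (P : seq (R * 'rV[int]_n)) : GRing.term R :=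
  foldr (fun u t =>
      GRing.Add (GRing.Mul (GRing.Const u.1) (monomial_term u.2)) t)
    (GRing.NatConst _ 0) P.

Lemma eval_monomial_term a x : pos_orthant x ->
  GRing.eval (env x) (monomial_term a) = expR (lin a (lnv x)).
Proof.
move=> xX; rewrite /lin -big_enum/= /monomial_term.
elim: (enum _) => [|i s IH]; first by rewrite big_nil expR0.
rewrite big_cons expRD /= IH; congr (_ * _).
rewrite mxE; have xi := xX i; case: (a ord0 i) => k /=.
  by rewrite nth_env expRM_natl lnK// posrE.
by rewrite nth_env NegzE mulrNz mulNr expRN expRM_natl lnK// posrE.
Qed.

Lemma eval_leval_term P x : pos_orthant x ->
  GRing.eval (env x) (leval_term P) = leval P x.
Proof.
move=> xX; rewrite /leval; elim: P => [|u P IH]; first by rewrite big_nil.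
by rewrite big_cons -IH /= eval_monomial_term.
Qed.

End Terms.

Section Formulas.
Import ordered_qelim.ord.
Context {R : realType} {n : nat}.
Implicit Types (x y : 'rV[R]_n) (S T : set 'rV[R]_n) (f : formula R).

Lemma laurent_eval t : GRing.rterm t -> laurent (fun x => GRing.eval (env x) t).
Proof.
elim: t => //=.
- move=> i _; have [iLn|nLi] := ltnP i n; last first.
    apply: eq_laurent (laurent_cst 0) => x _.
    by rewrite nth_default// size_env.
  apply: eq_laurent (laurent_coord (Ordinal iLn)) => x _.
  exact: (nth_env x (Ordinal iLn)).
- by move=> c _; exact: laurent_cst.
- by move=> k _; exact: laurent_cst.
- by move=> t IHt u IHu /andP[/IHt lt /IHu lu]; apply: laurentD.
- by move=> t IHt /IHt; exact: laurentN.
- move=> t IHt k /IHt lt.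
  apply: eq_laurent (laurentM (laurent_cst k%:R) lt) => x _.
  by rewrite mulr_natl.
- by move=> t IHt u IHu /andP[/IHt lt /IHu lu]; apply: laurentM.
- by move=> t IHt k /IHt lt; apply: laurentX.
Qed.

Lemma semialg_qf f : qf_form f -> rformula f ->
  semialg [set x : 'rV[R]_n | holds (env x) f].
Proof.
elim: f => //=.
- by move=> b _ _; exact: semialg_cst.
- move=> t u _ /andP[/laurent_eval lt /laurent_eval lu].
  by apply: eq_semialg (semialg_eq0 (laurentB lt lu)) => x _ /=;
    split=> [->|/eqP]; rewrite ?subrr// subr_eq0 => /eqP.
- move=> t u _ /andP[/laurent_eval lt /laurent_eval lu].
  by apply: eq_semialg (semialg_gt0 (laurentB lu lt)) => x _ /=;
    rewrite subr_gt0.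
- move=> t u _ /andP[/laurent_eval lt /laurent_eval lu].
  by apply: eq_semialg (semialg_ge0 (laurentB lu lt)) => x _ /=;
    rewrite subr_ge0.
- move=> f1 IH1 f2 IH2 /andP[q1 q2] /andP[r1 r2].
  exact: (semialgI (IH1 q1 r1) (IH2 q2 r2)).
- move=> f1 IH1 f2 IH2 /andP[q1 q2] /andP[r1 r2].
  exact: (semialgU (IH1 q1 r1) (IH2 q2 r2)).
- move=> f1 IH1 f2 IH2 /andP[q1 q2] /andP[r1 r2].
  apply: eq_semialg (semialgU (semialgC (IH1 q1 r1)) (IH2 q2 r2)) => x _ /=.
  split=> [f12|[nf1 /nf1//|]//].
  by have [/f12|] := pselect (holds (env x) f1); [right|left].
- by move=> f IH q r; exact: (semialgC (IH q r)).
Qed.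

(** Quantifier elimination: atoms of a quantifier-free ring formula are sign
    conditions on polynomials. *)
Lemma semialg_holds f : semialg [set x : 'rV[R]_n | holds (env x) f].
Proof.
pose g := quantifier_elim
    (fun i bc => qe_rcf.qfr_to_formula (@qe_rcf.wproj R i bc)) (to_rform f).
have /andP[qg rg] : qf_form g && rformula g.
  exact: (quantifier_elim_wf (@qe_rcf.wf_QE_wproj R) (to_rform_rformula f)).
apply: eq_semialg (semialg_qf qg rg) => x _ /=.
have gP := quantifier_elim_rformP (@qe_rcf.wf_QE_wproj R)
  (@qe_rcf.valid_QE_wproj R) (env x) (to_rform_rformula f).
rewrite -to_rformP; split=> [/gP/(qf_evalP _ qg)//|/(qf_evalP _ qg)/gP//].
Qed.

(** There are finitely many sign vectors, so the union of the cells contained in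
    S is a finite disjunction; it is built by induction on the list of Laurent
    polynomials, for an arbitrary set D of sign vectors. *)
Lemma semialg_to_formula S : semialg S ->
  exists f, forall x : 'rV[R]_n, pos_orthant x -> holds (env x) f <-> S x.
Proof.
move=> [Ps SPs].
have sign_formula (Qs : seq (seq (R * 'rV[int]_n))) (D : set (seq R)) :
    exists f, forall x : 'rV[R]_n, pos_orthant x ->
      holds (env x) f <-> D [seq Num.sg (leval Q x) | Q <- Qs].
  elim: Qs D => [|Q Qs IH] D.
    by exists (Bool `[< D [::] >]) => x _ /=; split=> /asboolP.
  have [f0 f0P] := IH [set s | D (0 :: s)].
  have [f1 f1P] := IH [set s | D (1 :: s)].
  have [f2 f2P] := IH [set s | D (-1 :: s)].
  pose t := leval_term Q; pose z : GRing.term R := GRing.NatConst _ 0.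
  exists (Or (And (Equal t z) f0) (Or (And (Lt z t) f1) (And (Lt t z) f2))).
  move=> x xX /=; rewrite eval_leval_term// f0P// f1P// f2P//=.
  case: sgrP => [null|pos|neg]; split => //.
  - by case=> [[]|[[]|[]]].
  - by move=> H; left.
  - by case=> [[e]|[[]|[]]]//; rewrite e ltxx in pos.
  - by move=> H; right; left.
  - by case=> [[e]|[[]|[]]]//; rewrite e ltxx in neg.
  - by move=> H; right; right.
have [f fP] := sign_formula Ps [set s | exists y, [/\ pos_orthant y, S y &
  s = [seq Num.sg (leval P y) | P <- Ps]]].
exists f => x xX; rewrite fP//; split=> [[y [yX Sy /eq_in_map xy]]|Sx].
  by apply: SPs Sy => // P /xy.
by exists x.
Qed.

Definition upd x (j : 'I_n) (t : R) : 'rV[R]_n :=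
  \row_i if i == j then t else x ord0 i.

Lemma set_nth_env x (j : 'I_n) t : set_nth 0 (env x) j t = env (upd x j t).
Proof.
apply: (@eq_from_nth _ 0).
  by rewrite size_set_nth !size_env; apply/maxn_idPr.
move=> i; rewrite size_set_nth size_env (maxn_idPr _)// => iLn.
rewrite nth_set_nth/= (nth_env (upd x j t) (Ordinal iLn)) mxE.
by rewrite -val_eqE/=; case: eqP => // _; exact: (nth_env x (Ordinal iLn)).
Qed.

Lemma semialg_exists1 (j : 'I_n) S : semialg S ->
  semialg [set x | exists2 t, 0 < t & S (upd x j t)].
Proof.
move=> /semialg_to_formula[f fP].
pose z : GRing.term R := GRing.NatConst _ 0.
pose g := Exists j (And (Lt z (GRing.Var _ j)) f).
apply: eq_semialg (semialg_holds g) => x xX /=.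
have updX t : 0 < t -> pos_orthant (upd x j t).
  by move=> t0 i; rewrite mxE; case: ifP.
split=> [[t t0 St]|[t]]; rewrite ?set_nth_env.
  exists t; rewrite set_nth_env nth_env mxE eqxx; split=> //.
  by apply/fP => //; apply: updX.
by rewrite nth_env mxE eqxx => -[t0 /(fP _ (updX _ t0)) St]; exists t.
Qed.

(** Projection to the coordinates in B, kept as a cylinder in the same space so
    that coordinates need not be renumbered: one quantifier is eliminated for
    each coordinate outside B. *)
Lemma semialg_proj (B : {set 'I_n}) S : semialg S ->
  semialg [set x | exists y, [/\ pos_orthant y,
    {in B, forall i, y ord0 i = x ord0 i} & S y]].
Proof.
move=> SAS.
suff elim_coords (s : seq 'I_n) : semialg [set x | exists y, [/\ pos_orthant y,
    forall i, i \notin s -> y ord0 i = x ord0 i & S y]].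
  apply: eq_semialg (elim_coords (enum (~: B))) => x _ /=.
  split=> -[y [yX yx Sy]]; exists y; split=> // i iB; apply: yx.
    by move: iB; rewrite mem_enum inE negbK.
  by rewrite mem_enum inE iB.
elim: s => [|j s IH].
  apply: eq_semialg SAS => x xX /=; split=> [[y [_ yx Sy]]|]; last by exists x.
  by rewrite (_ : x = y)//; apply/rowP => i; rewrite yx.
apply: eq_semialg (semialg_exists1 j IH) => x xX /=; split=> [[y [yX yx Sy]]|].
  exists (y ord0 j) => //; exists y; split=> // i nis; rewrite mxE.
  by case: eqVneq => [->//|ij]; rewrite yx// inE negb_or ij.
move=> [t _ [y [yX yx Sy]]]; exists y; split=> // i.
by rewrite inE negb_or => /andP[/negPf ij /yx]; rewrite mxE ij.
Qed.

End Formulas.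

(** * Dominant monomials along a filter *)

Section Dominance.
Context {R : realType} {n : nat}.
Implicit Types (x y : 'rV[R]_n) (a b : 'rV[int]_n) (F : seq 'rV[int]_n).
Implicit Types (p : set_system 'rV[R]_n) (B : {set 'I_n}).

Definition diverges p a := forall M : R, p [set x | M < lin a (lnv x)].

Definition supported B a := forall i, i \notin B -> a ord0 i = 0.

(** No nonzero integral combination of the log-coordinates in B stays bounded,
    in the strong form available along an ultrafilter. *)
Definition independent p B := forall a, supported B a -> a != 0 ->
  diverges p a \/ diverges p (- a).

Definition region F (M : R) : set 'rV[R]_n :=
  [set x | {in F, forall b, M < lin b (lnv x)}].

Lemma divergesD p {FF : Filter p} a b :
  diverges p a -> diverges p b -> diverges p (a + b).
Proof.
move=> ta tb M; apply: filterS (filterI (ta M) (tb 0)) => x [/= xa xb].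
by rewrite linD -[M]addr0 ltrD.
Qed.

Lemma region_cat F G M N x : region (F ++ G) (Num.max M N) x ->
  region F M x /\ region G N x.
Proof.
move=> FG; split=> b bF; apply: le_lt_trans (FG b _);
  by rewrite ?le_max ?lexx ?orbT// mem_cat bF ?orbT.
Qed.

Lemma filter_region p {FF : Filter p} F M :
  {in F, forall b, diverges p b} -> p (region F M).
Proof.
elim: F => [_|b F IH Fp]; first by apply: filterS filterT => x _.
have pb : diverges p b by apply: Fp; rewrite mem_head.
have pF : p (region F M) by apply: IH => c cF; apply: Fp; rewrite inE cF orbT.
apply: filterS (filterI (pb M) pF) => x [/= xb xF] c.
by rewrite inE => /orP[/eqP->//|/xF].
Qed.

(** Independence makes divergence of differences a total strict order on
    exponents supported in B, so a finite list has a greatest one. *)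
Lemma dominant_exponent p B {FF : Filter p} (l : seq 'rV[int]_n) :
  independent p B -> l != [::] -> {in l, forall a, supported B a} ->
  exists2 a, a \in l & {in l, forall b, b = a \/ diverges p (a - b)}.
Proof.
move=> indep; elim: l => // a l IH _ supp.
have [->|l0] := eqVneq l [::].
  by exists a; rewrite ?mem_head// => b; rewrite inE => /eqP; left.
have suppl : {in l, forall b, supported B b}.
  by move=> b bl; apply: supp; rewrite inE bl orbT.
have [m ml mmax] := IH l0 suppl.
have [am|am] := eqVneq a m.
  exists a => [|b]; rewrite ?mem_head// inE => /orP[/eqP|]; first by left.
  by rewrite am => /mmax.
have suppD : supported B (a - m).
  move=> i iB.
  by rewrite !mxE (suppl m ml _ iB) (supp a (mem_head _ _) _ iB) addr0.
have am0 : a - m != 0 by rewrite subr_eq0.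
have [big|small] := indep _ suppD am0.
  exists a => [|b]; rewrite ?mem_head// inE => /orP[/eqP|]; first by left.
  move=> /mmax[->|mb]; right => //.
  have -> : a - b = (a - m) + (m - b) by rewrite addrA subrK.
  exact: divergesD.
exists m => [|b]; first by rewrite inE ml orbT.
rewrite inE => /orP[/eqP->|/mmax//]; right.
by rewrite -opprB.
Qed.

Lemma sgr_perturb (c d : R) : `|d| < `|c| -> Num.sg (c + d) = Num.sg c.
Proof.
move=> dc; have [c0|c0|c0] := sgrP c.
- by move: dc; rewrite c0 normr0 normr_lt0.
- by apply: gtr0_sg; move: dc; rewrite (gtr0_norm c0) ltr_norml => /andP[]; lra.
- by apply: ltr0_sg; move: dc; rewrite (ltr0_norm c0) ltr_norml => /andP[]; lra.
Qed.

(** Factor out the dominant monomial: the remaining terms are as small as wanted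
    on a region, so the sign is that of the total coefficient C of this
    monomial.  If C vanishes, its terms cancel and fewer terms are left. *)
Lemma leval_sign_region p B {FF : Filter p} (P : seq (R * 'rV[int]_n)) :
  independent p B -> {in P, forall t, supported B t.2} ->
  exists F M s, {in F, forall b, diverges p b /\ supported B b} /\
    forall x, region F M x -> Num.sg (leval P x) = s.
Proof.
move=> indep; have [k] := ubnP (size P); elim: k P => // k IH P.
rewrite ltnS => sP supp; have [P0|P0] := eqVneq P [::].
  by exists [::], 0, 0; split=> // x _; rewrite P0 /leval big_nil sgr0.
have [||a aP amax] := @dominant_exponent p B _ [seq t.2 | t <- P] indep.
    by case: (P) P0.
  by move=> b /mapP[t tP ->]; apply: supp.
pose C : R := \sum_(t <- P | t.2 == a) t.1.
pose Q := [seq t <- P | t.2 != a].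
have PCQ x : leval P x = C * expR (lin a (lnv x)) + leval Q x.
  rewrite /leval big_filter (bigID (fun t => t.2 == a))/=; congr (_ + _).
  by rewrite /C big_distrl; apply: eq_bigr => t /eqP->.
have QP t : t \in Q -> t \in P by rewrite mem_filter => /andP[].
have [C0|C0] := eqVneq C 0.
  have [||F [M [s [Fp Fs]]]] := IH Q.
    apply: leq_trans sP; rewrite size_filter -(count_predC (fun t => t.2 == a)).
    rewrite -[X in (X < _)%N]add0n ltn_add2r -has_count.
    by case/mapP: aP => t tP ->; apply/hasP; exists t => /=.
    by move=> t /QP; apply: supp.
  by exists F, M, s; split=> // x /Fs; rewrite PCQ C0 mul0r add0r.
pose N : R := \sum_(t <- Q) `|t.1|.
have N0 : 0 <= N by apply: sumr_ge0 => t _.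
have cN0 : 0 < `|C| / (N + 1) by rewrite divr_gt0 ?normr_gt0// ltr_wpDl.
(* with this bound the remaining terms add up to at most N |C| / (N + 1) *)
exists [seq a - t.2 | t <- Q], (- ln (`|C| / (N + 1))), (Num.sg C); split.
  move=> _ /mapP[t tQ ->]; have := tQ; rewrite mem_filter => /andP[ta tP].
  split; first by have [/eqP|//] := amax t.2 (map_f _ tP); rewrite (negPf ta).
  move=> i iB; rewrite !mxE (supp t tP i iB).
  by case/mapP: aP => r rP ->; rewrite (supp r rP i iB) addr0.
move=> x xF.
have -> : leval P x = (C + \sum_(t <- Q) t.1 * expR (- lin (a - t.2) (lnv x)))
    * expR (lin a (lnv x)).
  rewrite PCQ mulrDl; congr (_ + _); rewrite big_distrl.
  apply: eq_bigr => t _ /=.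
  by rewrite -mulrA -expRD linB opprB subrK.
rewrite sgrM (gtr0_sg (expR_gt0 _)) mulr1; apply: sgr_perturb.
apply: (@le_lt_trans _ _ (N * (`|C| / (N + 1)))).
  apply: le_trans (ler_norm_sum _ _ _) _; rewrite /N big_distrl.
  rewrite big_seq [leRHS]big_seq; apply: ler_sum => t tQ /=.
  rewrite normrM ler_wpM2l// gtr0_norm ?expR_gt0//.
  rewrite -[leRHS]lnK ?posrE// ler_expR lerNl ltW//.
  by apply: xF; apply: map_f.
rewrite mulrA ltr_pdivrMr ?ltr_wpDl// mulrC ltr_pM2l ?normr_gt0//.
by rewrite ltrDl.
Qed.

(** A set that is a cylinder over the coordinates in B can be tested at points
    whose other coordinates are 1; this replaces exponents by exponents
    supported in B. *)
Definition restr B y : 'rV[R]_n := \row_i if i \in B then y ord0 i else 1.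

Definition restr_exp B a : 'rV[int]_n := \row_i if i \in B then a ord0 i else 0.

Lemma restr_pos B y : pos_orthant y -> pos_orthant (restr B y).
Proof. by move=> yX i; rewrite mxE; case: ifP. Qed.

Lemma lin_restr B a y : lin a (lnv (restr B y)) = lin (restr_exp B a) (lnv y).
Proof.
apply: eq_bigr => i _; rewrite !mxE; case: ifP => // _.
by rewrite ln1 mulr0 mul0r.
Qed.

(** Finitely many Laurent polynomials decide membership in the projection of S,
    and their signs are constant on a common region F, M; since S and that
    region belong to p, they share a point, which puts the whole region in the
    projection. *)
Lemma dominance p B {PF : ProperFilter p} (S : set 'rV[R]_n) :
  independent p B -> semialg S -> p (@pos_orthant R n) -> p S ->
  exists F M, {in F, forall b, diverges p b /\ supported B b} /\
    forall y, pos_orthant y -> region F M y ->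
    exists x, [/\ pos_orthant x, {in B, forall i, x ord0 i = y ord0 i} & S x].
Proof.
move=> indep /(semialg_proj B)[Ps].
set U := [set x | _] => UPs pX pS.
pose P' P : seq (R * 'rV[int]_n) := [seq (t.1, restr_exp B t.2) | t <- P].
have P'E P y : leval P (restr B y) = leval (P' P) y.
  by rewrite /leval big_map; apply: eq_bigr => t _; rewrite lin_restr.
have [F [M [Fp FM]]] : exists F M,
    {in F, forall b, diverges p b /\ supported B b} /\
    {in Ps, forall P, exists s, forall x, region F M x ->
      Num.sg (leval (P' P) x) = s}.
  elim: (Ps) => [|P Qs [F [M [Fp FM]]]]; first by exists [::], 0.
  have [|G [N [s [Gp Gs]]]] := @leval_sign_region p B _ (P' P) indep.
    by move=> _ /mapP[t _ ->] i /negPf iB; rewrite mxE iB.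
  exists (G ++ F), (Num.max N M); split=> [b|Q].
    by rewrite mem_cat => /orP[/Gp|/Fp].
  rewrite inE => /orP[/eqP->|/FM[r rP]].
    by exists s => x /region_cat[/Gs].
  by exists r => x /region_cat[_ /rP].
exists F, M; split=> // y yX yF.
have pF : p (region F M) by apply: filter_region => b /Fp[].
have [x [xX [Sx xF]]] := filter_ex (filterI pX (filterI pS pF)).
have Urx : U (restr B x) by exists x; split=> // i iB; rewrite mxE iB.
have [|z [zX zy Sz]] := UPs _ _ (restr_pos B xX) (restr_pos B yX) _ Urx.
  by move=> P /FM[s sP]; rewrite !P'E !sP.
by exists z; split=> // i iB; rewrite zy// mxE iB.
Qed.

End Dominance.

(** * The logarithmic limit set in rescaled log-coordinates *)

Section LogLimit.
Context {R : realType} {n : nat}.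
Implicit Types (x w : 'rV[R]_n) (V : set 'rV[R]_n).

Lemma expR_Nv_lt (s : R) : 0 < s -> expR (- s^-1) < s.
Proof.
move=> s0; rewrite expRN invf_plt ?posrE ?expR_gt0//.
by apply: lt_le_trans (expR_ge1Dx _); rewrite ltrDr.
Qed.

(** With s := 1 / ln (1/t), the point Log_(1/t) x is s times log x, and t -> 0
    means s -> 0. *)
Lemma log_limit_setP V w :
  log_limit_set V w <->
  forall e : R, 0 < e -> exists s x,
    [/\ 0 < s < e, V x & forall i, `|s * ln (x ord0 i) - w ord0 i| < e].
Proof.
rewrite /log_limit_set /family_lim.
set Y := [set p : 'rV[R]_n * R | _].
have Yw : Y (w, 0) by rewrite /Y/= lexx ltr01.
split=> [clw e e0|apx B].
  pose d := Num.min e (expR (- e^-1)).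
  have d0 : 0 < d by rewrite lt_min e0 expR_gt0.
  have [|[_ t] [[/andP[/= t0 t1] [x Vx <-]] [/= bw bt]]] :=
      clw (ball ((w, 0) : 'rV[R]_n * R) d).
    rewrite /nbhs/= -nbhs_subspace_in// /within/=.
    by apply: filterS (nbhsx_ballx _ _ d0) => q qB _.
  have ln_t : e^-1 < - ln t.
    rewrite ltrNr -ltr_expR lnK ?posrE//.
    move: bt; rewrite /ball/= sub0r normrN gtr0_norm// lt_min.
    by case/andP.
  have ei : 0 < e^-1 by rewrite invr_gt0.
  exists (- ln t)^-1, x; split=> // [|i].
    by rewrite invr_gt0 (lt_trans ei)//= invf_plt ?posrE// (lt_trans ei).
  have [_ /(_ ord0 i)] := bw.
  rewrite mxE mul1r lnV ?posrE// /ball/= distrC mulrC.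
  by move=> /lt_le_trans; apply; rewrite ge_min lexx.
rewrite /nbhs/= -nbhs_subspace_in// /within/= => /nbhs_ballP[d/= d0 dB].
pose e := Num.min d 1.
have e0 : 0 < e by rewrite lt_min d0 ltr01.
have ed : e <= d by rewrite ge_min lexx.
have [s [x [/andP[s0 se] Vx xw]]] := apx e e0.
have st := expR_Nv_lt s0.
have s1 : s < 1 by apply: lt_le_trans se _; rewrite ge_min lexx orbT.
have Et : 0 < expR (- s^-1) < 1 by rewrite expR_gt0/= (lt_trans st).
have logE : log_map (1 / expR (- s^-1)) x = s *: lnv x.
  by apply/rowP => i; rewrite !mxE mul1r -expRN opprK expRK invrK mulrC.
exists (s *: lnv x, expR (- s^-1)); split; first by split=> //=; exists x.
apply: dB; last by rewrite /Y/= ltW//=; case/andP: Et.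
split=> /=; last first.
  rewrite /ball/= sub0r normrN gtr0_norm ?expR_gt0//.
  by apply: lt_le_trans ed; apply: lt_trans se.
split=> // i j; rewrite (ord1 i) !mxE /ball/= distrC.
exact: lt_le_trans (xw j) ed.
Qed.

End LogLimit.

(** * Tropical limits of positive formulas *)

Section Dequantization.
Context {R : realType}.

(** In log-coordinates addition is maximum up to a bounded error; rescaling by
    s -> 0 removes the error. *)
Lemma ln_add_max (a b : R) : 0 < a -> 0 < b ->
  Num.max (ln a) (ln b) <= ln (a + b) <= Num.max (ln a) (ln b) + 1.
Proof.
move=> a0 b0; wlog ab : a b a0 b0 / a <= b.
  move=> H; have [/H->//|/ltW/H] := leP a b.
  by rewrite maxC addrC => ->.
have lab : ln a <= ln b by rewrite ler_ln ?posrE.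
rewrite (max_idPr lab) ler_ln ?posrE ?addr_gt0// lerDr ltW//=.
rewrite -ler_expR expRD !lnK ?posrE ?addr_gt0//.
have e2 : 2 <= expR (1 : R) by apply: le_trans (expR_ge1Dx 1).
apply: (@le_trans _ _ (b * 2)); last by rewrite ler_pM2l.
by rewrite mulr2n mulrDr mulr1 lerD2r.
Qed.

Lemma ler_dist_max (a b c d e : R) : `|a - c| <= e -> `|b - d| <= e ->
  `|Num.max a b - Num.max c d| <= e.
Proof.
rewrite !ler_norml => /andP[a1 a2] /andP[b1 b2].
by case: (leP a b); case: (leP c d) => h1 h2; apply/andP; split; lra.
Qed.

Lemma eval_pos_gt0 k (t : os_term R k) e : pos_orthant e ->
  0 < os_eval (os_pos R) e t.
Proof.
move=> eX; elim: t => [i|t IHt u IHu|t IHt u IHu|a t IHt] /=.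
- exact: eX.
- exact: addr_gt0.
- exact: mulr_gt0.
- exact: powR_gt0.
Qed.

(** The bound d is used both for s and for the distance of the two valuations,
    so that one constant L absorbs the error of each addition and the Lipschitz
    constant of the tropical term. *)
Lemma eval_dequantization k (t : os_term R k) : exists2 L : R, 0 <= L &
  forall (e w : 'rV[R]_k) (s d : R), pos_orthant e -> 0 <= s <= d ->
    (forall i, `|s * ln (e ord0 i) - w ord0 i| <= d) ->
    `|s * ln (os_eval (os_pos R) e t) - os_eval (os_trop R) w t| <= L * d.
Proof.
elim: t => [i|t [L L0 LP] u [M M0 MP]|t [L L0 LP] u [M M0 MP]|a t [L L0 LP]] /=.
- by exists 1 => // e w s d eX sd ew; rewrite mul1r.
- exists (L + M + 1); first by rewrite !addr_ge0.
  move=> e w s d eX sd ew.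
  have := LP e w s d eX sd ew; have := MP e w s d eX sd ew.
  have := eval_pos_gt0 t eX; have := eval_pos_gt0 u eX.
  set A := os_eval (os_pos R) e t; set B := os_eval (os_pos R) e u.
  set A' := os_eval _ w t; set B' := os_eval _ w u => B0 A0 MB LA.
  have /andP[s0 s_le_d] := sd; have d0 := le_trans s0 s_le_d.
  have Ld : 0 <= L * d by apply: mulr_ge0.
  have Md : 0 <= M * d by apply: mulr_ge0.
  have /(_ A' B' ((L + M) * d)) := @ler_dist_max (s * ln A) (s * ln B).
  rewrite -maxr_pMr// => H.
  have {}H : `|s * Num.max (ln A) (ln B) - Num.max A' B'| <= (L + M) * d.
    by apply: H; rewrite mulrDl; [rewrite ler_wpDr|rewrite ler_wpDl].
  have /andP[m1 m2] := ln_add_max A0 B0.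
  have n1 := ler_wpM2l s0 m1; have n2 := ler_wpM2l s0 m2.
  rewrite mulrDr mulr1 in n2; rewrite mulrDl mul1r.
  by move: H; rewrite !ler_norml => /andP[h1 h2]; apply/andP; split; lra.
- exists (L + M); first by rewrite addr_ge0.
  move=> e w s d eX sd ew.
  rewrite lnM ?posrE ?eval_pos_gt0// mulrDr opprD addrACA mulrDl.
  by apply: le_trans (ler_normD _ _) _; rewrite lerD ?LP ?MP.
- exists (`|a| * L); first by rewrite mulr_ge0.
  move=> e w s d eX sd ew.
  rewrite ln_powR mulrCA -mulrBr normrM -mulrA ler_wpM2l//.
  exact: LP.
Qed.

Lemma le_dequantization k (t u : os_term R k) (w : 'rV[R]_k) :
  ~ os_eval (os_trop R) w t <= os_eval (os_trop R) w u ->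
  exists2 d : R, 0 < d & forall e s, pos_orthant e -> 0 < s <= d ->
    (forall i, `|s * ln (e ord0 i) - w ord0 i| <= d) ->
    ~ os_eval (os_pos R) e t <= os_eval (os_pos R) e u.
Proof.
move=> /negP; rewrite -ltNge => gap.
have [L L0 LP] := eval_dequantization t.
have [M M0 MP] := eval_dequantization u.
move: gap; set A := os_eval _ w t; set B := os_eval _ w u => gap.
have LM0 : 0 < L + M + 1 by rewrite ltr_wpDl// addr_ge0.
exists ((A - B) / (L + M + 1)) => [|e s eX /andP[s0 sd] ew].
  by rewrite divr_gt0// subr_gt0.
set d := (A - B) / _ in sd ew.
have sd' : 0 <= s <= d by rewrite ltW.
have Lt := LP e w s d eX sd' ew; have Mu := MP e w s d eX sd' ew.
rewrite -ler_ln ?posrE ?eval_pos_gt0// -(ler_pM2l s0) => le_tu.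
have gapE : A - B = d * (L + M + 1) by rewrite divfK// gt_eqF.
have d0 : 0 < d by apply: lt_le_trans sd.
by move: Lt Mu; rewrite !ler_norml -/A -/B => /andP[l1 l2] /andP[m1 m2]; nra.
Qed.

(** Tropical truth of a positive formula is a closed condition, so its failure
    at w persists for all nearby rescaled points. *)
Lemma holds_dequantization k (phi : os_pqf R k) (w : 'rV[R]_k) :
  ~ os_holds (os_trop R) w phi ->
  exists2 d : R, 0 < d & forall e s, pos_orthant e -> 0 < s <= d ->
    (forall i, `|s * ln (e ord0 i) - w ord0 i| <= d) ->
    ~ os_holds (os_pos R) e phi.
Proof.
elim: phi => [t u|t u|f IHf g IHg|f IHf g IHg] /=.
- move=> /eqP; rewrite eq_le negb_and => /orP[/negP|/negP] /le_dequantization;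
    move=> [d d0 dP]; exists d => // e s eX sd ew tu; apply: (dP e s eX sd ew);
    by rewrite tu.
- exact: le_dequantization.
- move=> nfg; have [fw|/IHf[d d0 dP]] := pselect (os_holds (os_trop R) w f).
    have /IHg[d d0 dP] : ~ os_holds (os_trop R) w g by move=> gw; apply: nfg.
    by exists d => // e s eX sd ew [_]; apply: dP ew.
  by exists d => // e s eX sd ew [+ _]; apply: dP ew.
- move=> nfg.
  have /IHf[d d0 dP] : ~ os_holds (os_trop R) w f.
    by move=> fw; apply: nfg; left.
  have /IHg[c c0 cP] : ~ os_holds (os_trop R) w g.
    by move=> gw; apply: nfg; right.
  exists (Num.min d c) => [|e s eX /andP[s0]]; first by rewrite lt_min d0.
  rewrite le_min => /andP[sd sc] ew [].
    apply: (dP e s); rewrite ?s0 ?sd// => i; apply: le_trans (ew i) _.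
    by rewrite ge_min lexx.
  apply: (cP e s); rewrite ?s0 ?sc// => i; apply: le_trans (ew i) _.
  by rewrite ge_min lexx orbT.
Qed.

Context {n : nat}.
Implicit Types (V : set 'rV[R]_n).

Definition euler_row : 'rV[R]_1 := const_mx (expR 1).

Lemma row_mx_pos (x : 'rV[R]_n) : pos_orthant x ->
  pos_orthant (row_mx x euler_row).
Proof.
move=> xX i; rewrite mxE; case: (fintype.split i) => j //.
by rewrite mxE expR_gt0.
Qed.

(** The parameter e has logarithm 1, which rescales to the tropical value 0. *)
Lemma log_limit_set_sub V (phi : os_pqf R (n + 1)) : V `<=` @pos_orthant R n ->
  V `<=` [set x | os_holds (os_pos R) (row_mx x euler_row) phi] ->
  log_limit_set V `<=` [set w | os_holds (os_trop R) (row_mx w 0) phi].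
Proof.
move=> VX Vphi w /log_limit_setP Vw; apply: contrapT => /holds_dequantization.
move=> [d d0 dP]; have [s [x [/andP[s0 sd] Vx xw]]] := Vw d d0.
apply: (dP (row_mx x euler_row) s) (Vphi _ Vx).
- exact/row_mx_pos/VX.
- by rewrite s0 ltW.
- move=> i; rewrite !mxE; case: (fintype.split i) => j; first exact/ltW/xw.
  by rewrite !mxE expRK mulr1 subr0 gtr0_norm// ltW.
Qed.

End Dequantization.

(** * Covering a semi-algebraic set by thickened cones *)

Section ConeCover.
Context {R : realType} {n : nat}.
Implicit Types (x w : 'rV[R]_n) (a : 'rV[int]_n) (A : seq 'rV[int]_n) (K : R).
Implicit Types (p : set_system 'rV[R]_n) (V : set 'rV[R]_n).

Definition cone A : set 'rV[R]_n := [set w | {in A, forall a, lin a w <= 0}].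

(** In log-coordinates, part of a bounded neighbourhood of the cone. *)
Definition thick_cone A K : set 'rV[R]_n :=
  [set x | {in A, forall a, lin a (lnv x) <= K}].

Lemma semialg_thick_cone A K : semialg (thick_cone A K).
Proof.
apply: semialg_forall => a _.
have lf := laurentB (laurent_cst (expR K)) (@laurent_monomial R n a).
by apply: eq_semialg (semialg_ge0 lf) => x _ /=; rewrite subr_ge0 ler_expR.
Qed.

Lemma thick_coneW A A' K K' x : {subset A' <= A} -> K <= K' ->
  thick_cone A K x -> thick_cone A' K' x.
Proof. by move=> AA' KK' xA a /AA'/xA /le_trans; apply. Qed.

Lemma thick_cone_cat A A' K x :
  thick_cone A K x -> thick_cone A' K x -> thick_cone (A ++ A') K x.
Proof.
by move=> xA xA' a; rewrite mem_cat => /orP[/xA|/xA'].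
Qed.

Definition bounded_exp p a :=
  exists K, p [set x | lin a (lnv x) <= K /\ - K <= lin a (lnv x)].

Lemma ultra_exp p {FU : UltraFilter p} a :
  [\/ bounded_exp p a, diverges p a | diverges p (- a)].
Proof.
have [da|/existsNP[M nda]] := pselect (diverges p a).
  by constructor 2.
have [dN|/existsNP[N ndN]] := pselect (diverges p (- a)).
  by constructor 3.
constructor 1; exists (Num.max M N).
have [//|pa] := in_ultra_setVsetC [set x | M < lin a (lnv x)] FU.
have [//|pN] := in_ultra_setVsetC [set x | N < lin (- a) (lnv x)] FU.
apply: filterS (filterI pa pN) => x [/= /negP + /negP].
rewrite -!leNgt linN => xM xN; split; first by rewrite le_max xM.
by rewrite lerNl le_max xN orbT.
Qed.

Lemma bounded_thick_cone p {FF : Filter p} A :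
  {in A, forall a, bounded_exp p a} ->
  exists K, p (thick_cone (A ++ [seq - a | a <- A]) K).
Proof.
elim: A => [_|a A IH bA]; first by exists 0; apply: filterS filterT => x _.
have [K pK] : exists K, p (thick_cone (A ++ [seq - a | a <- A]) K).
  by apply: IH => b bA'; apply: bA; rewrite inE bA' orbT.
have [L pL] := bA a (mem_head _ _).
exists (Num.max K L); apply: filterS (filterI pK pL) => x [/= xK [xL Lx]] b.
have KM : K <= Num.max K L by rewrite le_max lexx.
have LM : L <= Num.max K L by rewrite le_max lexx orbT.
rewrite inE mem_cat inE => /or3P[/eqP->|bA'|/orP[/eqP->|bA']].
- exact: le_trans LM.
- by apply: le_trans KM; apply: xK; rewrite mem_cat bA'.
- by apply: le_trans LM; rewrite linN lerNl.
- by apply: le_trans KM; apply: xK; rewrite mem_cat bA' orbT.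
Qed.

(** Take a maximal independent B; each further coordinate then enters a relation
    in which it has a nonzero coefficient. *)
Lemma monomial_basis p {FU : UltraFilter p} : exists B : {set 'I_n},
  independent p B /\ forall j, j \notin B -> exists a,
    [/\ supported (j |: B) a, a ord0 j != 0 & bounded_exp p a].
Proof.
have ind0 : `[< independent p finset.set0 >].
  apply/asboolP => a a0 /eqP[]; apply/rowP => i.
  by rewrite a0 ?mxE// finset.in_set0.
have [B /maxsetP[/asboolP indB maxB] _] :=
  @maxset_exists _ (fun B => `[< independent p B >]) _ ind0.
exists B; split=> // j jB.
have : ~ independent p (j |: B).
  move=> /asboolP/maxB/(_ (finset.subsetUr _ _))/finset.setP/(_ j).
  by rewrite in_setU1 eqxx (negPf jB).
move=> /existsNP[a] /not_implyP[suppa] /not_implyP[a0] /not_orP[nda ndNa].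
have bdda : bounded_exp p a by have [] := @ultra_exp p _ a.
exists a; split=> //; apply/eqP => aj0.
have [||/nda|/ndNa]// := indB a => // i iB.
have [->//|ij] := eqVneq i j.
by apply: suppa; rewrite in_setU1 negb_or ij.
Qed.

(** Solves a relation for its coordinate j; the coefficient is a nonzero
    integer, hence at least 1 in absolute value. *)
Lemma coord_bound (a : 'rV[int]_n) (B : {set 'I_n}) j (v u : 'rV[R]_n) (K : R) :
  supported (j |: B) a -> a ord0 j != 0 -> j \notin B ->
  {in B, forall i, v ord0 i = u ord0 i} -> `|lin a v| <= K ->
  `|v ord0 j| <= K + \sum_i `|(a ord0 i)%:~R| * `|u ord0 i|.
Proof.
move=> suppa aj0 jB vu av.
have aj1 : 1 <= `|(a ord0 j)%:~R : R|.
  by rewrite -intr_norm ler1z -gtz0_ge1 normr_gt0.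
apply: (@le_trans _ _ (`|(a ord0 j)%:~R| * `|v ord0 j|)).
  by rewrite ler_peMl.
rewrite -normrM.
have -> : (a ord0 j)%:~R * v ord0 j =
    lin a v - \sum_(i | i != j) (a ord0 i)%:~R * v ord0 i.
  by rewrite /lin (bigD1 j)//= addrK.
apply: le_trans (ler_normB _ _) _; apply: lerD => //.
rewrite [leRHS](bigD1 j)//= ler_wpDl ?mulr_ge0//.
apply: le_trans (ler_norm_sum _ _ _) _; apply: ler_sum => i ij.
rewrite normrM; have [iB|iB] := boolP (i \in B); first by rewrite vu.
by rewrite suppa ?normr0 ?mul0r// in_setU1 negb_or ij.
Qed.

(** On an ultrafilter containing V, the relations of [monomial_basis] hold up to
    a bounded factor, and dominance provides points of V over a whole region of
    the basis coordinates.  The cone is given by the relations together with the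
    inequalities of the region.  To approximate a point w of it, move w slightly
    into the interior in the direction of an actual point of the region, and
    scale up. *)
Lemma local_cone p {FU : UltraFilter p} V :
  semialg V -> V `<=` @pos_orthant R n -> p V ->
  exists A K, cone A `<=` log_limit_set V /\ p (thick_cone A K).
Proof.
move=> SAV VX pV; have pX : p (@pos_orthant R n) by apply: filterS pV.
have [B [indB depB]] := @monomial_basis p _.
have /choice[rel relP] : forall j, exists a, j \notin B ->
    [/\ supported (j |: B) a, a ord0 j != 0 & bounded_exp p a].
  by move=> j; have [jB|/depB[a]] := boolP (j \in B); [exists 0|exists a].
pose E := [seq rel j | j <- enum (~: B)].
have [a|K pK] := @bounded_thick_cone p _ E.
  by move=> /mapP[j]; rewrite mem_enum inE => /relP[_ _ bj] ->.
set E2 := E ++ _ in pK.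
have SAW := semialgI SAV (semialg_thick_cone E2 K).
have [F [M [FpB FM]]] := dominance indB SAW pX (filterI pV pK).
have Fp : {in F, forall b, diverges p b} by move=> b /FpB[].
exists (E2 ++ [seq - b | b <- F]), (Num.max K (- M)); split; last first.
  apply: filterS (filterI pK (filter_region M Fp)) => x [/= xK xM].
  apply: thick_cone_cat.
    by apply: thick_coneW xK => //; rewrite le_max lexx.
  move=> _ /mapP[b bF ->]; rewrite linN le_max lerN2 (ltW (xM b bF)).
  by rewrite orbT.
have [x0 [x0X x0F]] := filter_ex (filterI pX (filter_region 1 Fp)).
pose w0 := lnv x0.
pose N : R := 1 + \sum_i `|w0 ord0 i|
  + \sum_j \sum_i `|(rel j ord0 i)%:~R| * `|w0 ord0 i|.
have sum0 j : 0 <= \sum_i `|(rel j ord0 i)%:~R : R| * `|w0 ord0 i|.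
  by apply: sumr_ge0 => i _; rewrite mulr_ge0.
have N1 : 1 <= N by rewrite /N -addrA lerDl addr_ge0 ?sumr_ge0.
have Ni i : `|w0 ord0 i| <= N.
  rewrite /N (bigD1 i)//= -!addrA addrCA lerDl !addr_ge0 ?sumr_ge0//.
have Nj j : \sum_i `|(rel j ord0 i)%:~R| * `|w0 ord0 i| <= N.
  by rewrite /N [X in _ + X](bigD1 j)//= addrCA lerDl !addr_ge0// sumr_ge0.
move=> w wC; apply/log_limit_setP => e e0.
(* h is the size of the move towards w0, and s is small enough for the moved
   point to be in the region after division by s *)
pose h := e / (4 * N).
have N0 : 0 < N by apply: lt_le_trans N1.
have h0 : 0 < h by rewrite divr_gt0// mulr_gt0.
have hN : h * N = e / 4 by rewrite /h; field; rewrite gt_eqF.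
pose s := Num.min (e / 2) (Num.min (h / (`|M| + 1)) (e / (4 * (`|K| + 1)))).
have M10 : 0 < `|M| + 1 by rewrite ltr_wpDl.
have K10 : 0 < `|K| + 1 by rewrite ltr_wpDl.
have s0 : 0 < s by rewrite !lt_min !divr_gt0// mulr_gt0.
have sM : s * (`|M| + 1) <= h.
  by rewrite -ler_pdivlMr// !ge_min lexx orbT.
have sK : s * (`|K| + 1) <= e / 4.
  have -> : e / 4 = e / (4 * (`|K| + 1)) * (`|K| + 1).
    by field; rewrite gt_eqF.
  by rewrite ler_pM2r// !ge_min lexx !orbT.
have se : s < e.
  apply: (@le_lt_trans _ _ (e / 2)); first by rewrite ge_min lexx.
  by rewrite ltr_pdivrMr// ltr_pMr// ltr1n.
pose y := expv (s^-1 *: (w + h *: w0)).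
have yF : region F M y.
  move=> b bF; rewrite expvK linZr ltr_pdivlMl// linDr linZr.
  have bw : 0 <= lin b w.
    by rewrite -oppr_le0 -linN; apply: wC; rewrite mem_cat map_f ?orbT.
  have bw0 : h < h * lin b w0 by rewrite ltr_pMr//; exact: x0F.
  have := ler_norm M; nra.
have [x [xX xy [Vx xK]]] := FM y (expv_pos _) yF.
exists s, x; split; rewrite ?s0 ?se//.
pose v := s *: lnv x - w.
have vi i : v ord0 i = s * ln (x ord0 i) - w ord0 i by rewrite !mxE.
have vB : {in B, forall i, v ord0 i = (h *: w0) ord0 i}.
  move=> i iB; rewrite vi xy// /y !mxE expRK mulVKf ?gt_eqF//.
  by rewrite addrAC subrr add0r.
move=> i; rewrite -vi; have [iB|iB] := boolP (i \in B).
  rewrite vB// mxE normrM gtr0_norm//.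
  apply: (@le_lt_trans _ _ (h * N)); first by rewrite ler_pM2l.
  by rewrite hN ltr_pdivrMr// ltr_pMr// ltr1n.
have [suppi reli bi] := relP i iB.
have relE : rel i \in E by apply: map_f; rewrite mem_enum inE.
have E2E : rel i \in E2 by rewrite mem_cat relE.
have E2N : - rel i \in E2 by rewrite mem_cat orbC map_f.
have wE a : a \in E2 -> lin a w <= 0.
  by move=> aE; apply: wC; rewrite mem_cat aE.
have wrel : lin (rel i) w = 0.
  apply/le_anti/andP; split; first exact: wE.
  by rewrite -oppr_le0 -linN; apply: wE.
have vrel : `|lin (rel i) v| <= s * `|K|.
  rewrite /v linDr linZr -[- w]scaleN1r linZr wrel mulr0 addr0.
  rewrite normrM gtr0_norm// ler_pM2l// ler_norml lerNl -linN.
  by rewrite !(le_trans _ (ler_norm K))// xK.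
apply: le_lt_trans (coord_bound suppi reli iB vB vrel) _.
have -> : \sum_j `|(rel i ord0 j)%:~R| * `|(h *: w0) ord0 j| =
    h * \sum_j `|(rel i ord0 j)%:~R| * `|w0 ord0 j|.
  rewrite big_distrr; apply: eq_bigr => j _ /=.
  by rewrite mxE normrM (gtr0_norm h0) mulrCA.
have := Nj i; rewrite -(ler_pM2l h0) hN; lra.
Qed.

(** If no finite family covered V, the complements of all admissible thickened
    cones would lie in a common ultrafilter, contradicting [local_cone]. *)
Lemma cone_cover V : semialg V -> V `<=` @pos_orthant R n ->
  exists l : seq (seq 'rV[int]_n * R),
    {in l, forall c, cone c.1 `<=` log_limit_set V} /\
    forall x, V x -> exists2 c, c \in l & thick_cone c.1 c.2 x.
Proof.
move=> SAV VX; apply: contrapT => noncover.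
pose good (l : seq (seq 'rV[int]_n * R)) :=
  {in l, forall c, cone c.1 `<=` log_limit_set V}.
pose rest (l : seq (seq 'rV[int]_n * R)) :=
  [set x | V x /\ {in l, forall c, ~ thick_cone c.1 c.2 x}].
have PF : ProperFilter (filter_from good rest).
  apply: filter_from_proper.
    apply: filter_from_filter; first by exists [::].
    move=> l m gl gm; exists (l ++ m).
      by move=> c; rewrite mem_cat => /orP[/gl|/gm].
    move=> x [Vx xlm]; split; split=> // c cl; apply: xlm;
      by rewrite mem_cat cl ?orbT.
  move=> l gl; apply: contrapT => nl; apply: noncover.
  exists l; split=> // x Vx.
  apply: contrapT => nx; apply: nl; exists x; split=> // c cl xc.
  by apply: nx; exists c.
have [p [pU restp]] := ultraFilterLemma PF.
have pV : p V by apply: restp; exists [::] => // x [].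
have [A [K [AV pA]]] := local_cone SAV VX pV.
have pN : p (rest [:: (A, K)]).
  apply: restp; exists [:: (A, K)] => // c; rewrite inE => /eqP->.
  exact: AV.
have [x [xA [_ xN]]] := filter_ex (filterI pA pN).
exact: xN (mem_head _ _) xA.
Qed.

End ConeCover.

(** * Positively definable sets *)

Section PositiveDefinability.
Context {R : realType} {n : nat}.
Implicit Types (x w : 'rV[R]_n) (a : 'rV[int]_n) (S T : set 'rV[R]_n).

Definition par_term : os_term R (n + 1) := OSVar R (rshift n ord0).

(** A constant c > 0 as the value of the power ln c at the parameter e; its
    tropical value is 0. *)
Definition cst_term (c : R) : os_term R (n + 1) := OSPow (ln c) par_term.

Definition monomial_os_term a : os_term R (n + 1) :=
  foldr (fun i t => OSMul (OSPow (a ord0 i)%:~R (OSVar R (lshift 1 i))) t)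
    (cst_term 1) (enum 'I_n).

Lemma eval_cst_pos c x : 0 < c ->
  os_eval (os_pos R) (row_mx x euler_row) (cst_term c) = c.
Proof. by move=> c0; rewrite /= row_mxEr mxE -expRM mul1r lnK. Qed.

Lemma eval_cst_trop c w : os_eval (os_trop R) (row_mx w 0) (cst_term c) = 0.
Proof. by rewrite /= row_mxEr mxE mulr0. Qed.

Lemma eval_monomial_pos a x : pos_orthant x ->
  os_eval (os_pos R) (row_mx x euler_row) (monomial_os_term a) =
  expR (lin a (lnv x)).
Proof.
move=> xX; rewrite /lin -big_enum/= /monomial_os_term.
elim: (enum _) => [|i s IH].
  by rewrite big_nil expR0 -[RHS](eval_cst_pos x).
rewrite big_cons expRD /= IH; congr (_ * _).
by rewrite row_mxEl mxE mulrC expRM lnK// posrE.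
Qed.

Lemma eval_monomial_trop a w :
  os_eval (os_trop R) (row_mx w 0) (monomial_os_term a) = lin a w.
Proof.
rewrite /lin -big_enum/= /monomial_os_term.
elim: (enum _) => [|i s IH]; first by rewrite big_nil eval_cst_trop.
by rewrite big_cons /= IH row_mxEl.
Qed.

(** Short for positively definable: no negation in the formula, and e as the
    only parameter. *)
Definition posdef S := exists phi : os_pqf R (n + 1),
  forall x, pos_orthant x ->
    S x <-> os_holds (os_pos R) (row_mx x euler_row) phi.

Lemma eq_posdef S T : (forall x, pos_orthant x -> T x <-> S x) ->
  posdef S -> posdef T.
Proof. by move=> ST [phi SP]; exists phi => x xX; rewrite ST// SP. Qed.

Lemma posdef_setT : posdef setT.
Proof. by exists (OSEq par_term par_term) => x xX; split. Qed.

(** In positive reals 1 + 1 <= 1 is false. *)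
Lemma posdef_set0 : posdef set0.
Proof.
exists (OSLe (OSAdd (cst_term 1) (cst_term 1)) (cst_term 1)) => x xX.
by split=> //=; have /= -> := eval_cst_pos x ltr01; rewrite gerDl ler10.
Qed.

Lemma posdefI S T : posdef S -> posdef T -> posdef (S `&` T).
Proof.
by move=> [f fP] [g gP]; exists (OSAnd f g) => x xX /=; rewrite -fP// -gP.
Qed.

Lemma posdefU S T : posdef S -> posdef T -> posdef (S `|` T).
Proof.
by move=> [f fP] [g gP]; exists (OSOr f g) => x xX /=; rewrite -fP// -gP.
Qed.

Lemma posdef_forall (I : eqType) (s : seq I) (F : I -> set 'rV[R]_n) :
  {in s, forall i, posdef (F i)} -> posdef [set x | {in s, forall i, F i x}].
Proof.
elim: s => [_|i s IH sF].
  by apply: eq_posdef posdef_setT => x _; split.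
have Pi : posdef (F i) by apply: sF; rewrite mem_head.
have Ps : posdef [set x | {in s, forall i, F i x}].
  by apply: IH => j js; apply: sF; rewrite inE js orbT.
apply: eq_posdef (posdefI Pi Ps) => x _; split => /= [H|[Hi H] j].
  by split=> [|j js]; apply: H; rewrite inE ?eqxx ?js ?orbT.
by rewrite inE => /orP[/eqP->//|/H].
Qed.

Lemma posdef_exists (I : eqType) (s : seq I) (F : I -> set 'rV[R]_n) :
  {in s, forall i, posdef (F i)} -> posdef [set x | exists2 i, i \in s & F i x].
Proof.
elim: s => [_|i s IH sF].
  by apply: eq_posdef posdef_set0 => x _; split=> // -[].
have Pi : posdef (F i) by apply: sF; rewrite mem_head.
have Ps : posdef [set x | exists2 i, i \in s & F i x].
  by apply: IH => j js; apply: sF; rewrite inE js orbT.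
apply: eq_posdef (posdefU Pi Ps) => x _; split => /= [[j]|[Fi|[j js Fj]]].
- by rewrite inE => /orP[/eqP->|js Fj]; [left|right; exists j].
- by exists i; rewrite ?mem_head.
- by exists j; rewrite // inE js orbT.
Qed.

(** There is no term for 0, so 1 is added to make the empty sum a term. *)
Definition sum_os_term (P : seq (R * 'rV[int]_n)) : os_term R (n + 1) :=
  foldr (fun u t => OSAdd (OSMul (cst_term u.1) (monomial_os_term u.2)) t)
    (cst_term 1) P.

Lemma eval_sum_pos P x : pos_orthant x -> {in P, forall u, 0 < u.1} ->
  os_eval (os_pos R) (row_mx x euler_row) (sum_os_term P) = leval P x + 1.
Proof.
move=> xX; rewrite /leval; elim: P => [_|u P IH P0].
  by rewrite big_nil add0r eval_cst_pos.
rewrite big_cons -addrA -IH => [|v vP]; last by apply: P0; rewrite inE vP orbT.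
rewrite -(eval_monomial_pos _ xX) -[X in X * _](eval_cst_pos x)//.
by apply: P0; rewrite mem_head.
Qed.

(** Move the terms with negative coefficients to the other side. *)
Lemma posdef_ge0 (f : 'rV[R]_n -> R) : laurent f -> posdef [set x | 0 <= f x].
Proof.
move=> [P fP]; pose P1 := [seq u <- P | 0 < u.1].
pose P2 := [seq (- u.1, u.2) | u <- P & u.1 < 0].
exists (OSLe (sum_os_term P2) (sum_os_term P1)) => x xX /=.
rewrite !eval_sum_pos//; last 2 first.
- by move=> u; rewrite mem_filter => /andP[].
- by move=> _ /mapP[v + ->]; rewrite mem_filter oppr_gt0 => /andP[].
rewrite lerD2r fP//; suff -> : leval P x = leval P1 x - leval P2 x.
  by rewrite subr_ge0.
rewrite /leval big_map !big_filter -sumrN [LHS](bigID (fun u => 0 < u.1))/=.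
congr (_ + _); rewrite (bigID (fun u => u.1 < 0))/= [X in _ + X]big1 ?addr0.
  apply: eq_big => u; last by move=> _; rewrite mulNr opprK.
  by case: (ltgtP u.1 0).
move=> u /andP[]; rewrite -!leNgt => u1 u2.
by rewrite (_ : u.1 = 0) ?mul0r//; apply/le_anti; rewrite u1.
Qed.

Definition cone_formula (c : seq 'rV[int]_n * R) : os_pqf R (n + 1) :=
  foldr (fun a f => OSAnd (OSLe (monomial_os_term a) (cst_term (expR c.2))) f)
    (OSEq par_term par_term) c.1.

Lemma cone_formula_pos c x : pos_orthant x ->
  os_holds (os_pos R) (row_mx x euler_row) (cone_formula c) <->
  thick_cone c.1 c.2 x.
Proof.
move=> xX; case: c => A K; rewrite /cone_formula/=.
elim: A => [|a A IH] //=.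
have /= -> := eval_cst_pos x (expR_gt0 K).
rewrite eval_monomial_pos// ler_expR IH.
split=> [[xa xA] b|xA]; first by rewrite inE => /orP[/eqP->|]; last exact: xA.
by split=> [|b bA]; apply: xA; rewrite inE ?eqxx ?bA ?orbT.
Qed.

Lemma cone_formula_trop c w :
  os_holds (os_trop R) (row_mx w 0) (cone_formula c) <-> cone c.1 w.
Proof.
case: c => A K; rewrite /cone_formula/=.
elim: A => [|a A IH] //=.
have /= -> := eval_cst_trop (expR K) w.
rewrite eval_monomial_trop IH.
split=> [[xa xA] b|xA]; first by rewrite inE => /orP[/eqP->|]; last exact: xA.
by split=> [|b bA]; apply: xA; rewrite inE ?eqxx ?bA ?orbT.
Qed.

Lemma holds_big_or M (e : 'rV[R]_(n + 1)) (I : eqType) (i : I) (s : seq I) F :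
  os_holds M e (foldr (fun j f => OSOr (F j) f) (F i) s) <->
  exists2 j, j \in i :: s & os_holds M e (F j).
Proof.
elim: s => [|j s IH] /=.
  split=> [Fi|[j]]; first by exists i; rewrite ?mem_head.
  by rewrite inE => /eqP->.
split=> [[Fj|/IH[k ks Fk]]|[k]].
- by exists j; rewrite // !inE eqxx orbT.
- by exists k => //; move: ks; rewrite !inE => /orP[->|->]; rewrite ?orbT.
- rewrite !inE => /or3P[/eqP->|/eqP->|ks] Fk; [right|by left|right].
    by apply/IH; exists i; rewrite ?mem_head.
  by apply/IH; exists k; rewrite // inE ks orbT.
Qed.

End PositiveDefinability.

(** * A Lojasiewicz inequality *)

Section Limits.
Context {R : realType} {n : nat}.
Implicit Types (p : set_system 'rV[R]_n).

Lemma cvg_sum_seq (T I : Type) (F : set_system T) {FF : Filter F} (s : seq I)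
    (f : I -> T -> R) (l : I -> R) :
  (forall i, f i x @[x --> F] --> l i) ->
  \sum_(i <- s) f i x @[x --> F] --> \sum_(i <- s) l i.
Proof. by move=> fl; apply: cvg_big => //; exact: add_continuous. Qed.

Lemma cvg_laurent p {FF : Filter p} (x0 : 'rV[R]_n) (f : 'rV[R]_n -> R) :
  laurent f -> p --> x0 -> pos_orthant x0 -> p (@pos_orthant R n) ->
  f x @[x --> p] --> f x0.
Proof.
move=> [P fP] px x0X pX.
have nearf : {near p, leval P =1 f}.
  by apply: filterS pX => x xX; rewrite fP.
apply: (cvg_trans (near_eq_cvg nearf)).
rewrite fP// /leval; apply: cvg_sum_seq => t.
apply: cvgM; first exact: cvg_cst.
apply: (@continuous_cvg _ _ _ p _ (fun x => lin t.2 (lnv x)) expR).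
  exact: continuous_expR.
apply: cvg_sum_seq => i; apply: cvgM; first exact: cvg_cst.
rewrite mxE; under eq_cvg do rewrite mxE.
apply: continuous_cvg; first exact: continuous_ln.
by apply: (@continuous_cvg _ _ _ p _ id (fun x : 'rV[R]_n => x ord0 i)) => //;
  exact: coord_continuous.
Qed.

End Limits.

Section Lift.
Context {R : realType} {n m : nat}.

Lemma lin_row_mx0 (a : 'rV[int]_n) (w : 'rV[R]_(n + m)) :
  lin (row_mx a 0) w = lin a (lsubmx w).
Proof.
rewrite /lin big_split_ord/= [X in _ + X]big1 ?addr0 => [|i _].
  by apply: eq_bigr => i _; rewrite row_mxEl mxE.
by rewrite row_mxEr mxE mul0r.
Qed.

Lemma lsubmx_pos (z : 'rV[R]_(n + m)) : pos_orthant z -> pos_orthant (lsubmx z).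
Proof. by move=> zX i; rewrite mxE. Qed.

Lemma lnv_lsubmx (z : 'rV[R]_(n + m)) : lsubmx (lnv z) = lnv (lsubmx z).
Proof. by apply/rowP => i; rewrite !mxE. Qed.

Definition lift_exps (P : seq (R * 'rV[int]_n)) : seq (R * 'rV[int]_(n + m)) :=
  [seq (t.1, row_mx t.2 0) | t <- P].

Lemma leval_lift P (z : 'rV[R]_(n + m)) :
  leval (lift_exps P) z = leval P (lsubmx z).
Proof.
rewrite /leval big_map; apply: eq_bigr => t _ /=.
by rewrite lin_row_mx0 lnv_lsubmx.
Qed.

Lemma laurent_lsubmx (f : 'rV[R]_n -> R) : laurent f ->
  laurent (fun z : 'rV[R]_(n + m) => f (lsubmx z)).
Proof.
move=> [P fP]; exists (lift_exps P) => z zX.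
by rewrite fP ?leval_lift//; exact: lsubmx_pos.
Qed.

Lemma semialg_lsubmx (S : set 'rV[R]_n) : semialg S ->
  semialg [set z : 'rV[R]_(n + m) | S (lsubmx z)].
Proof.
move=> [Ps SPs]; exists (map lift_exps Ps) => y z yX zX yz.
apply: SPs; [exact: lsubmx_pos|exact: lsubmx_pos|].
by move=> P PPs; rewrite -!leval_lift; apply/yz/map_f.
Qed.

End Lift.

Section Lojasiewicz.
Context {R : realType} {n : nat}.
Variables (V : set 'rV[R]_n) (I : eqType) (s : seq I).
Variables (f : 'rV[R]_n -> R) (g : I -> 'rV[R]_n -> R).
Hypothesis V_pos : V `<=` @pos_orthant R n.
Hypothesis V_closed : closed (V : set (subspace (@pos_orthant R n))).
Hypothesis SAV : semialg V.
Hypothesis lf : laurent f.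
Hypothesis lg : {in s, forall i, laurent (g i)}.

Let W : set 'rV[R]_n := [set x | V x /\ {in s, forall i, 0 < g i x}].
Hypothesis f_gt0 : forall x, W x -> 0 < f x.

Let G (x : 'rV[R]_n) : R := \prod_(i <- s) g i x.
(** A proper function on the orthant: its sublevel sets are closed in the whole
    space and bounded.  Being at least 2, it has powers that
    tend to infinity. *)
Definition height (x : 'rV[R]_n) : R :=
  2 + \sum_i (x ord0 i + (x ord0 i)^-1).
Let u (x : 'rV[R]_n) : R := height x + (G x)^-1.

Let G_gt0 x : W x -> 0 < G x.
Proof. by move=> [_ gx]; rewrite /G big_seq; apply: prodr_gt0 => i /gx. Qed.

Lemma height_bounds (x : 'rV[R]_n) : pos_orthant x ->
  2 <= height x /\ forall i, x ord0 i <= height x /\ (x ord0 i)^-1 <= height x.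
Proof.
move=> xX; have x0 i : 0 <= x ord0 i + (x ord0 i)^-1.
  by rewrite addr_ge0 ?invr_ge0 ?ltW ?xX.
split=> [|i]; first by rewrite lerDl sumr_ge0.
have xi : x ord0 i + (x ord0 i)^-1 <= height x.
  by rewrite /height (bigD1 i)//= addrCA lerDl addr_ge0 ?sumr_ge0.
have xi0 : 0 < x ord0 i by exact: xX.
have xV0 : 0 < (x ord0 i)^-1 by rewrite invr_gt0.
by split; apply: le_trans xi; rewrite ?lerDl ?lerDr ltW.
Qed.

Let u_ge2 x : W x -> 2 <= u x.
Proof.
move=> Wx; have [h2 _] := height_bounds (V_pos Wx.1).
by rewrite /u ler_wpDr// invr_ge0 ltW// G_gt0.
Qed.

(** The sets on which u is bounded have compact closure in the orthant, and a
    limit point still satisfies all g_i > 0 because the product of the g_i stays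
    away from 0; so f, positive there, is bounded away from 0. *)
Let compact_bound K :
  exists2 c : R, 0 < c & forall x, W x -> u x <= K -> c <= f x.
Proof.
apply: contrapT => nocb.
pose T (c : R) := [set x | [/\ W x, u x <= K & f x < c]].
have PF : ProperFilter (filter_from [set c : R | 0 < c] T).
  apply: filter_from_proper.
    apply: filter_from_filter; first by exists 1; rewrite /= ltr01.
    move=> c d /= c0 d0; exists (Num.min c d); first by rewrite /= lt_min c0.
    by move=> x [Wx ux]; rewrite lt_min => /andP[xc xd].
  move=> c /= c0; apply: contrapT => Tc0; apply: nocb; exists c => // x Wx ux.
  by rewrite leNgt; apply/negP => fc; apply: Tc0; exists x.
have [p [pU Tp]] := ultraFilterLemma PF.
have pT c : 0 < c -> p (T c) by move=> c0; apply: Tp; exists c.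
have pX : p (@pos_orthant R n).
  by apply: filterS (pT 1 ltr01) => x [[/V_pos]].
have K0 : 0 < K.
  have [x []] := filter_ex (pT 1 ltr01).
  by move=> /u_ge2 u2 uK _; apply: lt_le_trans uK; apply: lt_le_trans u2.
have : compact [set v : 'rV[R]_n | forall i, `[K^-1, K]%classic (v ord0 i)].
  apply: (@rV_compact _ _ (fun=> `[K^-1, K]%classic)) => i.
  exact: segment_compact.
rewrite compact_ultra => /(_ p pU)[|x0 [/= x0box px0]].
  apply: filterS (pT 1 ltr01) => x [Wx uK _] i /=.
  have xX := V_pos Wx.1; have [_ /(_ i)[xi xiV]] := height_bounds xX.
  have hK : height x <= K.
    by apply: le_trans uK; rewrite /u lerDl invr_ge0 ltW// G_gt0.
  rewrite in_itv/= (le_trans xi)// andbT.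
  by rewrite -[leRHS]invrK lef_pV2 ?posrE ?invr_gt0 ?xX ?(le_trans xiV).
have x0X : pos_orthant x0.
  move=> i; have /= := x0box i; rewrite in_itv/= => /andP[+ _].
  by apply: lt_le_trans; rewrite invr_gt0.
have Vx0 : V x0.
  have /closed_subspaceP[C C_closed CV] := V_closed.
  have : (C `&` @pos_orthant R n) x0.
    split=> //; apply: (@closed_cvg _ _ p _ id C C_closed _ _ px0).
    apply: filterS (pT 1 ltr01) => y [[Vy _] _ _].
    suff [] : (C `&` @pos_orthant R n) y by [].
    by rewrite CV; split=> //; exact: V_pos.
  by rewrite CV => -[].
have lim (h : 'rV[R]_n -> R) : laurent h -> h @ p --> h x0.
  by move=> lh; exact: cvg_laurent.
have g_ge0 : {in s, forall i, 0 <= g i x0}.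
  move=> i si; apply: (@cvgr_to_ge _ p _ R (g i) (g i x0) 0 (lim _ (lg si))).
  by apply: filterS (pT 1 ltr01) => y [[_ gy] _ _]; apply/ltW/gy.
have G_ge : K^-1 <= G x0.
  apply: (cvgr_to_ge (lim _ (laurent_prod lg))).
  apply: filterS (pT 1 ltr01) => y [Wy uK _].
  have Gy := G_gt0 Wy; rewrite -[leRHS]invrK lef_pV2 ?posrE ?invr_gt0//.
  apply: le_trans uK; rewrite /u lerDr.
  by have [h2 _] := height_bounds (V_pos Wy.1); apply: le_trans h2.
have Wx0 : W x0.
  split=> // i si; rewrite lt_def g_ge0// andbT; apply/eqP => gi0.
  have : 0 < G x0 by apply: lt_le_trans G_ge; rewrite invr_gt0.
  by rewrite /G (big_rem i)//= gi0 mul0r ltxx.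
have fx0 := f_gt0 Wx0.
have : f x0 <= f x0 / 2.
  apply: (cvgr_to_le (lim _ lf)).
  have f20 : 0 < f x0 / 2 by rewrite divr_gt0.
  by apply: filterS (pT _ f20) => y [_ _ /ltW].
by lra.
Qed.

Lemma laurent_height : laurent height.
Proof.
apply: laurentD; first exact: laurent_cst.
by apply: laurent_sum => i _; apply: laurentD;
  [exact: laurent_coord|exact: laurent_coordV].
Qed.

Let laurent_G : laurent G.
Proof. exact: laurent_prod. Qed.

Let iu : 'I_(n + 2) := rshift n ord0.
Let iv : 'I_(n + 2) := rshift n ord_max.

(** V with two more coordinates, the values of u and f; dominance is applied to
    these two. *)
Let graph : set 'rV[R]_(n + 2) :=
  [set z | [/\ W (lsubmx z), z ord0 iu = u (lsubmx z) &
               z ord0 iv = f (lsubmx z)]].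

Let semialg_graph : semialg graph.
Proof.
have SAW : semialg W.
  apply: (semialgI SAV); apply: semialg_forall => i si.
  by apply: semialg_gt0; exact: lg.
have l1 : laurent (fun z : 'rV[R]_(n + 2) =>
    z ord0 iu * G (lsubmx z) - (height (lsubmx z) * G (lsubmx z) + 1)).
  have lG := @laurent_lsubmx R n 2 _ laurent_G.
  have lh := @laurent_lsubmx R n 2 _ laurent_height.
  apply: laurentB; first by apply: laurentM lG; exact: laurent_coord.
  by apply: laurentD; [exact: laurentM|exact: laurent_cst].
have l2 : laurent (fun z : 'rV[R]_(n + 2) => z ord0 iv - f (lsubmx z)).
  by apply: laurentB; [exact: laurent_coord|exact: laurent_lsubmx].
have SA12 := semialgI (semialg_eq0 l1) (semialg_eq0 l2).
apply: eq_semialg (semialgI (semialg_lsubmx SAW) SA12) => z zX /=.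
have uE : W (lsubmx z) -> z ord0 iu = u (lsubmx z) <->
    z ord0 iu * G (lsubmx z) - (height (lsubmx z) * G (lsubmx z) + 1) = 0.
  move=> /G_gt0; set y := lsubmx z => Gy.
  have uG : u y * G y = height y * G y + 1.
    by rewrite [LHS]mulrDl mulVf// gt_eqF.
  split=> [->|/eqP]; first by rewrite uG subrr.
  by rewrite subr_eq0 -uG => /eqP; apply: mulIf; rewrite gt_eqF.
split=> [[Wz e1 e2]|[Wz [/(uE Wz) e1 /eqP]]].
  by split=> //; split; [exact/uE|rewrite e2 subrr].
by rewrite subr_eq0 => /eqP.
Qed.

Let point (x : 'rV[R]_n) : 'rV[R]_(n + 2) :=
  row_mx x (\row_j if j == ord0 then u x else f x).

Let point_u x : point x ord0 iu = u x.
Proof. by rewrite row_mxEr mxE. Qed.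

Let point_f x : point x ord0 iv = f x.
Proof. by rewrite row_mxEr mxE. Qed.

Let point_pos x : W x -> pos_orthant (point x).
Proof.
move=> Wx i; rewrite mxE; case: (fintype.split i) => j.
  exact: (V_pos Wx.1).
rewrite mxE; case: ifP => _; last exact: f_gt0.
exact: lt_le_trans (u_ge2 Wx).
Qed.

Let point_graph x : W x -> graph (point x).
Proof. by move=> Wx; split; rewrite ?point_u ?point_f row_mxKl. Qed.

Let uf_coords : {set 'I_(n + 2)} := [set iu; iv].

Let lin_point (a : 'rV[int]_(n + 2)) x : supported uf_coords a ->
  lin a (lnv (point x)) =
  (a ord0 iu)%:~R * ln (u x) + (a ord0 iv)%:~R * ln (f x).
Proof.
move=> suppa; have uv : iv != iu by rewrite -val_eqE/= eqn_add2l.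
rewrite /lin (bigD1 iu)//= (bigD1 iv)//= !lnvE point_u point_f big1 ?addr0//.
move=> i /andP[iNu iNv]; rewrite suppa ?mul0r// !inE negb_or.
by rewrite iNu.
Qed.

(** Along a filter on which f u^k < 1 for every k, u must be unbounded by
    compactness.  Then log u and log f are independent, and divergence of an
    exponent is decided lexicographically, log f first.  So a region given by
    dominance contains, with a point (u, f), all (u, d) with d <= f, which
    contradicts the lower bound for f where u is bounded. *)
Lemma lojasiewicz : exists k, forall x, W x -> 1 <= f x * u x ^+ k.
Proof.
apply: contrapT => noloj.
pose T k := [set x | W x /\ f x * u x ^+ k < 1].
have T0 k : T k !=set0.
  apply: contrapT => Tk0; apply: noloj; exists k => x Wx.
  by rewrite leNgt; apply/negP => fk; apply: Tk0; exists x.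
have Tmono k l : (k <= l)%N -> T l `<=` T k.
  move=> kl x [Wx fl]; split=> //; apply: le_lt_trans fl.
  rewrite ler_pM2l ?f_gt0// ler_weXn2l//.
  by apply: le_trans (u_ge2 Wx); rewrite ler1n.
have unbounded k (K : R) : exists2 x, T k x & K < u x.
  apply: contrapT => nx.
  have Tu x : T k x -> u x <= K.
    by move=> Tx; rewrite leNgt; apply/negP => Ku; apply: nx; exists x.
  have [c c0 fc] := compact_bound K.
  pose l := maxn k (Num.bound c^-1).
  have [x Tx] := T0 l; have Tkx := Tmono _ _ (leq_maxl _ _) _ Tx.
  have [Wx] := Tx; apply/negP; rewrite -leNgt.
  apply: (@le_trans _ _ (c * 2 ^+ l)); last first.
    rewrite ler_pM ?exprn_ge0 ?(ltW c0)//; first by apply: fc => //; exact: Tu.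
    by rewrite lerXn2r ?nnegrE ?u_ge2// (le_trans _ (u_ge2 Wx)).
  rewrite -ler_pdivrMl// mulr1.
  have : c^-1 < (Num.bound c^-1)%:R.
    by apply: archi_boundP; rewrite invr_ge0 ltW.
  move=> /ltW/le_trans; apply; apply: (@le_trans _ _ l%:R).
    by rewrite ler_nat leq_maxr.
  by rewrite -natrX ler_nat ltnW// ltn_expl.
pose rest k := [set x | T k x /\ k%:R < u x].
pose p0 := filter_from [set: nat] rest.
have PF0 : ProperFilter p0.
  apply: filter_from_proper => [|k _]; last first.
    by have [x Tx ux] := unbounded k k%:R; exists x.
  apply: filter_from_filter; first by exists 0.
  move=> k l _ _; exists (maxn k l) => // x [Tx ux]; split; split.
  - exact: Tmono (leq_maxl _ _) _ Tx.
  - by apply: le_lt_trans ux; rewrite ler_nat leq_maxl.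
  - exact: Tmono (leq_maxr _ _) _ Tx.
  - by apply: le_lt_trans ux; rewrite ler_nat leq_maxr.
pose p := point @ p0.
have p0W : p0 W by exists 0 => // x [[]].
have u_big (M : R) : p0 [set x | M < ln (u x)].
  exists (Num.bound (expR M)) => // x [[Wx _] ux] /=.
  have u0 : 0 < u x by apply: lt_le_trans (u_ge2 Wx).
  rewrite -ltr_expR lnK ?posrE//; apply: lt_trans ux.
  by apply: archi_boundP; rewrite expR_ge0.
have f_small (k : nat) : p0 [set x | ln (f x) <= - (k%:R * ln (u x))].
  exists k => // x [[Wx fk] _] /=.
  have f0 := f_gt0 Wx; have u0 : 0 < u x by apply: lt_le_trans (u_ge2 Wx).
  have : ln (f x * u x ^+ k) <= 0 by apply: ln_le0; exact: ltW.
  have uk0 : 0 < u x ^+ k by apply: exprn_gt0.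
  by rewrite lnM ?posrE// lnXn// -mulr_natl => h; lra.
have diverges_lex a : supported uf_coords a ->
    a ord0 iv < 0 \/ a ord0 iv = 0 /\ 0 < a ord0 iu -> diverges p a.
  move=> suppa lex M.
  have := f_small (`|a ord0 iu|%N.+1).
  have := u_big (Num.max M 0); rewrite /p /fmap /=.
  apply: filterS2 => x /=; rewrite gt_max => /andP[uM u0] fk.
  rewrite lin_point//; case: lex => [av|[-> au]]; last first.
    rewrite mul0r addr0; apply: lt_le_trans uM _.
    by apply: ler_peMl; [exact: ltW|rewrite ler1z -gtz0_ge1].
  have av1 : (a ord0 iv)%:~R <= -1 :> R.
    by rewrite -[-1]/((-1)%:~R) ler_int; lia.
  have au : - (`|a ord0 iu|%N)%:R <= (a ord0 iu)%:~R :> R.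
    by rewrite -[X in - X]/((`|a ord0 iu|%N : int)%:~R) -mulrNz ler_int; lia.
  move: fk; rewrite -natr1 mulrDl mul1r => fk.
  have nL : 0 <= (`|a ord0 iu|%N)%:R * ln (u x) by rewrite mulr_ge0// ltW.
  move: av1 au fk nL uM u0.
  move: (a ord0 iv)%:~R (a ord0 iu)%:~R (`|_|%N)%:R (ln (u x)) (ln (f x)).
  move=> b a' m L l b1 a'm l_le mL ML L0.
  have bl : 0 <= (- 1 - b) * (- l) by apply: mulr_ge0; lra.
  have aL : 0 <= (a' + m) * L by apply: mulr_ge0; lra.
  by lra.
have indep : independent p uf_coords.
  move=> a suppa a0.
  have suppN : supported uf_coords (- a).
    by move=> i iuv; rewrite mxE suppa ?oppr0.
  have [av|av|av] := ltgtP (a ord0 iv) 0.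
  - by left; apply: diverges_lex => //; left.
  - by right; apply: diverges_lex => //; left; rewrite mxE oppr_lt0.
  have [au|au|au] := ltgtP (a ord0 iu) 0.
  - right; apply: diverges_lex => //; right; rewrite !mxE av oppr0.
    by rewrite oppr_gt0.
  - by left; apply: diverges_lex => //; right.
  case/eqP: a0; apply/rowP => i; rewrite mxE.
  have [|/suppa//] := boolP (i \in uf_coords).
  by rewrite !inE => /orP[/eqP->|/eqP->].
have pX : p (@pos_orthant R (n + 2)).
  by rewrite /p /fmap/=; apply: filterS p0W => x; exact: point_pos.
have pG : p graph.
  by rewrite /p /fmap/=; apply: filterS p0W => x; exact: point_graph.
have [F [M [Fp FM]]] := dominance indep semialg_graph pX pG.
have F_iv b : b \in F -> b ord0 iv <= 0.
  move=> bF; rewrite leNgt; apply/negP => bv; have [db suppb] := Fp _ bF.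
  have dN : diverges p (- b).
    apply: diverges_lex; last by left; rewrite mxE oppr_lt0.
    by move=> i iuv; rewrite mxE suppb ?oppr0.
  have [z [/= z1]] := filter_ex (filterI (db 0) (dN 0)).
  by rewrite linN oppr_gt0 ltNge ltW.
have p0F : p0 (point @^-1` region F M).
  exact: (filter_region M (fun b bF => (Fp b bF).1)).
have [x [Wx xF]] := filter_ex (filterI p0W p0F).
have [c c0 fc] := compact_bound (u x).
pose d := Num.min (f x) (c / 2).
have fx0 := f_gt0 Wx.
have d0 : 0 < d by rewrite lt_min fx0 divr_gt0.
have dfx : d <= f x by rewrite ge_min lexx.
pose y := upd (point x) iv d.
have yX : pos_orthant y.
  by move=> i; rewrite mxE; case: ifP => // _; exact: (point_pos Wx).
have yF : region F M y.
  move=> b bF; apply: lt_le_trans (xF b bF) _; have [_ suppb] := Fp b bF.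
  apply: ler_sum => i _; rewrite !lnvE [y ord0 i]mxE.
  case: eqVneq => [->|//]; rewrite point_f.
  by rewrite ler_wnM2l ?lerz0 ?F_iv// ler_ln ?posrE.
have [z [zX zy [Wz zu zf]]] := FM y yX yF.
have : c <= f (lsubmx z).
  apply: fc => //; rewrite -zu zy ?inE ?eqxx// mxE.
  by rewrite -val_eqE/= eqn_add2l/= point_u.
rewrite -zf zy ?inE ?eqxx ?orbT// mxE eqxx => cd.
have : d <= c / 2 by rewrite ge_min lexx orbT.
by lra.
Qed.

End Lojasiewicz.

(** * The finiteness theorem and the conclusion *)

Section Finiteness.
Context {R : realType} {n : nat}.
Implicit Types (x y : 'rV[R]_n) (V : set 'rV[R]_n).
Implicit Types (P : seq (R * 'rV[int]_n)).

(** The cell of y is {f = 0, all g_P > 0}, where f is the sum of the squares of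
    the polynomials vanishing at y and g_P is P with the sign it has at y.  The
    Lojasiewicz inequality, multiplied by G^k, becomes polynomial. *)
Lemma posdef_avoid_cell V Ps y : V `<=` @pos_orthant R n ->
  closed (V : set (subspace (@pos_orthant R n))) -> sign_determined Ps V ->
  pos_orthant y -> ~ V y ->
  exists C, [/\ posdef C, V `<=` C & forall x, pos_orthant x ->
    {in Ps, forall P, Num.sg (leval P x) = Num.sg (leval P y)} -> ~ C x].
Proof.
move=> VX Vcl VPs yX nVy.
pose s := [seq P <- Ps | leval P y != 0].
pose f x := \sum_(P <- Ps | leval P y == 0) leval P x ^+ 2.
pose g P x := Num.sg (leval P y) * leval P x.
have lf : laurent f.
  have := @laurent_sum R n _ [seq P <- Ps | leval P y == 0]
    (fun P x => leval P x ^+ 2).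
  case=> [P _|Q QP]; first exact/laurentX/laurentP.
  by exists Q => x xX; rewrite /f -QP// big_filter.
have lg : {in s, forall P, laurent (g P)}.
  by move=> P _; apply: laurentM; [exact: laurent_cst|exact: laurentP].
have f_gt0 x : V x /\ {in s, forall P, 0 < g P x} -> 0 < f x.
  move=> [Vx gx]; rewrite lt_def.
  have -> : 0 <= f x by apply: sumr_ge0 => P _; exact: sqr_ge0.
  rewrite andbT.
  apply/negP => fx0; apply: nVy; apply: VPs (Vx) => //; first exact: VX.
  move=> P PPs; have [Py|Py] := eqVneq (leval P y) 0.
    move: fx0; rewrite /f psumr_eq0 => [|Q _]; last exact: sqr_ge0.
    by move=> /allP/(_ P PPs); rewrite Py eqxx/= expf_eq0/= => /eqP->.
  have := gx P; rewrite mem_filter Py => /(_ PPs).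
  rewrite /g; case: sgrP Py => // _ _; rewrite ?mul1r ?mulN1r => Px.
    by rewrite gtr0_sg.
  by rewrite ltr0_sg// -oppr_gt0.
have [k loj] := lojasiewicz VX Vcl (ex_intro _ Ps VPs) lf lg f_gt0.
pose G x := \prod_(P <- s) g P x.
have lG : laurent G by exact: laurent_prod.
have lQ : laurent (fun x => f x * (height x * G x + 1) ^+ k - G x ^+ k).
  apply: laurentB; last exact: laurentX.
  apply: laurentM => //; apply: laurentX.
  apply: laurentD; last exact: laurent_cst.
  by apply: laurentM => //; exact: laurent_height.
exists ([set x | exists2 P, P \in s & 0 <= - g P x] `|`
  [set x | 0 <= f x * (height x * G x + 1) ^+ k - G x ^+ k]); split.
- apply: posdefU (posdef_ge0 lQ).
  apply: posdef_exists => P Ps'.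
  exact/posdef_ge0/laurentN/lg.
- move=> x Vx; have [gx|ngx] := pselect {in s, forall P, 0 < g P x}.
    right => /=; have Gx : 0 < G x.
      by rewrite /G big_seq; apply: prodr_gt0 => P /gx.
    have hG : height x * G x + 1 = (height x + (G x)^-1) * G x.
      by rewrite [RHS]mulrDl mulVf// gt_eqF.
    rewrite subr_ge0 hG exprMn mulrA; apply: ler_peMl.
      exact/exprn_ge0/ltW.
    exact: loj (conj Vx gx).
  left => /=; apply: contrapT => nx; apply: ngx => P Ps'.
  rewrite ltNge; apply/negP => gP; apply: nx.
  by exists P => //; rewrite oppr_ge0.
- move=> x xX xy.
  have gx P : P \in s -> 0 < g P x.
    rewrite mem_filter => /andP[Py PPs]; rewrite /g -xy// -normrEsg normr_gt0.
    by rewrite -sgr_eq0 xy// sgr_eq0.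
  have fx : f x = 0.
    rewrite /f big_seq_cond big1// => P /andP[PPs /eqP Py].
    have /eqP : Num.sg (leval P x) = 0 by rewrite xy// Py sgr0.
    by rewrite sgr_eq0 => /eqP->; rewrite expr0n.
  move=> [[P Ps']|]/=; first by rewrite oppr_ge0 leNgt gx.
  rewrite fx mul0r sub0r oppr_ge0 leNgt exprn_gt0//.
  by rewrite /G big_seq; apply: prodr_gt0 => P /gx.
Qed.

(** V is the intersection of the sets avoiding one cell, over the finitely many
    sign vectors t. *)
Lemma closed_posdef V : V `<=` @pos_orthant R n ->
  closed (V : set (subspace (@pos_orthant R n))) -> semialg V -> posdef V.
Proof.
move=> VX Vcl [Ps VPs].
pose signs x := [seq Num.sg (leval P x) | P <- Ps].
have [L LP] : exists L : seq (seq R), forall x, signs x \in L.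
  rewrite /signs; elim: (Ps) => [|P Qs [L LP]]; first by exists [:: [::]].
  exists [seq c :: t | c <- [:: 0; 1; -1], t <- L] => x.
  apply/allpairsP.
  exists (Num.sg (leval P x), [seq Num.sg (leval Q x) | Q <- Qs]).
  by split=> //=; rewrite !inE; case: sgrP; rewrite eqxx ?orbT.
have /choice[C CP] : forall t : seq R, exists C, [/\ posdef C, V `<=` C &
    forall x, pos_orthant x -> ~ V x -> signs x = t -> ~ C x].
  move=> t; have [[y [yX nVy yt]]|none] :=
      pselect (exists y, [/\ pos_orthant y, ~ V y & signs y = t]).
    have [C [PDC VC Cy]] := posdef_avoid_cell VX Vcl VPs yX nVy.
    exists C; split=> // x xX _ xt; apply: Cy => // P PPs.
    by have /eq_in_map/(_ P PPs) : signs x = signs y by rewrite xt yt.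
  exists setT; split=> //; first exact: posdef_setT.
  by move=> x xX nVx xt _; apply: none; exists x.
apply: eq_posdef (@posdef_forall _ _ _ L C _) => [x xX /=|t _]; last first.
  by have [] := CP t.
split=> [Vx t _|Cx]; first by have [_ VC _] := CP t; exact: VC.
apply: contrapT => nVx; have [_ _ nC] := CP (signs x).
exact: nC xX nVx erefl (Cx _ (LP x)).
Qed.

End Finiteness.

Theorem corollary6p7 (R : realType) (n : nat) (V : set 'rV[R]_n)
    (V_neq0 : V !=set0)
    (V_pos : V `<=` @pos_orthant R n)
    (V_closed : closed (V : set (subspace (@pos_orthant R n))))
    (V_semialg : semialgebraic V) :
  exists (m : nat) (phi : os_pqf R (n + m)) (a : 'rV[R]_m),
    [/\ pos_orthant a,
        V = [set x | pos_orthant x /\ os_holds (os_pos R) (row_mx x a) phi]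
      & log_limit_set V = [set x | os_holds (os_trop R) (row_mx x 0) phi]].
Proof.
have SAV : semialg V.
  by have [f ->] := V_semialg; exact: semialg_holds.
have [phi phiP] := closed_posdef V_pos V_closed SAV.
have [l [lcone lcover]] := cone_cover SAV V_pos.
have [c [m lE]] : exists c m, l = c :: m.
  have [x /lcover[c cl _]] := V_neq0; case: (l) cl => // d m _.
  by exists d, m.
pose psi := foldr (fun d f => OSOr (cone_formula d) f) (cone_formula c) m.
have psiP M e : os_holds M e psi <->
    exists2 d, d \in l & os_holds M e (cone_formula d).
  by rewrite lE; exact: holds_big_or.
have VE : V = [set x | pos_orthant x /\
    os_holds (os_pos R) (row_mx x euler_row) (OSAnd phi psi)].
  apply/seteqP; split=> [x Vx|x [xX [/phiP Vx _]]]; last exact: Vx.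
  have xX := V_pos _ Vx; split=> //; split; first exact/phiP.
  apply/psiP; have [d dl xd] := lcover x Vx.
  by exists d => //; apply/cone_formula_pos.
exists 1, (OSAnd phi psi), euler_row; split=> //.
  by move=> i; rewrite mxE expR_gt0.
apply/seteqP; split.
  by apply: log_limit_set_sub => // x; rewrite {1}VE => -[].
move=> w [_ /psiP[d dl /cone_formula_trop wd]].
exact: lcone dl _ wd.
Qed.
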